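(* Let $F$ be a graph with a color-critical edge and let $k+1=\chi(F)$. Let $H$ be a linear forest. Then $H$ is $F$-Turán-good, i.e., there is $n_0$ such that for all $n\ge n_0$, $$\mathrm{ex}(n,H,F)=\mathcal{N}(H,T(n,k)).$$ In particular, for every $k\ge 2$ and every $\ell\ge 1$, the path $P_\ell$ is $K_{k+1}$-Turán-good: for all sufficiently large $n$, among all $n$-vertex $K_{k+1}$-free graphs, the Turán graph $T(n,k)$ contains the maximum number of copies of $P_\ell$.
   Context: For graphs $H$ and $G$, $\mathcal{N}(H,G)$ denotes the number of (not necessarily induced) subgraphs of $G$ isomorphic to $H$ (''copies'' of $H$ in $G$). For graphs $H,F$, $\mathrm{ex}(n,H,F)$ is the maximum of $\mathcal{N}(H,G)$ over all $n$-vertex graphs $G$ containing no subgraph isomorphic to $F$. The Turán graph $T(n,k)$ is the complete $k$-partite graph on $n$ vertices with each part of size $\lfloor n/k\rfloor$ or $\lceil n/k\rceil$. An edge of $F$ is color-critical if deleting it decreases the chromatic number $\chi(F)$. For a graph $F$ with $\chi(F)=k+1$, a graph $H$ is called $F$-Turán-good if $\mathrm{ex}(n,H,F)=\mathcal{N}(H,T(n,k))$ for all sufficiently large $n$. A linear forest is a graph each of whose connected components is a path; $P_\ell$ denotes the path on $\ell$ vertices. *)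

(* Defs.v *)
(* Finite simple graphs are given by a finite vertex type V
   and an edge set E : {set {set V}} whose elements all have exactly 2 vertices. *)
From mathcomp Require Import all_boot.

Set Implicit Arguments.
Unset Strict Implicit.
Unset Printing Implicit Defensive.

Definition sgraph (V : finType) (E : {set {set V}}) : bool :=
  [forall e in E, #|e| == 2].

Definition ghom (V W : finType) (E : {set {set V}}) (G : {set {set W}})
  (f : V -> W) : bool := [forall e in E, (f @: e) \in G].

Definition embeddings (V W : finType) (E : {set {set V}}) (G : {set {set W}})
  : {set {ffun V -> W}} := [set f : {ffun V -> W} | injectiveb f && ghom E G f].

(* the subgraphs (vertex set, edge set) of G isomorphic to E: exactly the
   images of embeddings of E into G *)
Definition copies (V W : finType) (E : {set {set V}}) (G : {set {set W}})
  : {set ({set W} * {set {set W}})} :=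
  [set (f @: [set: V], [set f @: e | e : {set V} in E]) | f : {ffun V -> W} in embeddings E G].

Definition Ncopies (V W : finType) (E : {set {set V}}) (G : {set {set W}}) : nat :=
  #|copies E G|.

Definition Ffree (U W : finType) (F : {set {set U}}) (G : {set {set W}}) : bool :=
  embeddings F G == set0.

Definition colorable (V : finType) (E : {set {set V}}) (k : nat) : bool :=
  [exists c : {ffun V -> 'I_k},
     [forall x, forall y, ([set x; y] \in E) ==> (c x != c y)]].

Definition chi (V : finType) (E : {set {set V}}) : nat :=
  \big[minn/#|V|]_(k < #|V|.+1 | colorable E k) (k : nat).

Definition has_color_critical_edge (V : finType) (E : {set {set V}}) : bool :=
  [exists e in E, chi (E :\ e) < chi E].

(* Turan graph T(n,k): vertex i lies in part (i mod k); parts have sizes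
   floor(n/k) or ceil(n/k); edges join vertices in distinct parts *)
Definition turan (n k : nat) : {set {set 'I_n}} :=
  [set e : {set 'I_n} | [exists x : 'I_n, exists y : 'I_n,
     (e == [set x; y]) && (x %% k != y %% k)]].

Definition exHF (n : nat) (U V : finType) (H : {set {set V}}) (F : {set {set U}})
  : nat :=
  \max_(G : {set {set 'I_n}} | sgraph G && Ffree F G) Ncopies H G.

Definition path_graph (l : nat) : {set {set 'I_l}} :=
  [set e : {set 'I_l} | [exists i : 'I_l, exists j : 'I_l,
     (e == [set i; j]) && (i.+1 == j :> nat)]].

Definition complete (m : nat) : {set {set 'I_m}} :=
  [set e : {set 'I_m} | [exists i : 'I_m, exists j : 'I_m,
     (e == [set i; j]) && (i != j)]].

Definition gadj (V : finType) (E : {set {set V}}) : rel V :=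
  fun x y => [set x; y] \in E.

Definition component (V : finType) (E : {set {set V}}) (v : V) : {set V} :=
  [set y | connect (gadj E) v y].

Definition is_path_on (V : finType) (E : {set {set V}}) (C : {set V}) : Prop :=
  exists g : 'I_#|C| -> V,
    [/\ injective g, (forall i, g i \in C) &
        (forall i j, ([set g i; g j] \in E) =
                     ((i.+1 == j :> nat) || (j.+1 == i :> nat)))].

Definition linear_forest (V : finType) (E : {set {set V}}) : Prop :=
  sgraph E /\ forall v : V, is_path_on E (component E v).

(* Main.v *)
Require Import Defs.
From mathcomp Require Import all_boot all_order all_algebra.
From mathcomp Require Import perm.
From mathcomp Require Import zify ring lra.

(** Copies of H correspond to embeddings of H up to automorphisms of H, so embeddings are
    counted.  Let alpha = 1 - 1/k and let G be an F-free graph on n vertices.  As F is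
    contained in every large blow-up of K_{k+1}, G has few copies of K_{k+1}, and the
    inequality of Motzkin and Straus x^T A x <= alpha (sum x)^2 holds for the weights
    0 <= x <= 1 up to an error of o(n^2).  Applied to the numbers of walks it shows that
    the density W_l of walks with l edges satisfies W_l <= alpha^(l-1) W_1 + o(1).  Hence
    if G has at least as many embeddings of H as the Turan graph, then G has at least
    (alpha - o(1)) n^2 / 2 edges.  Then G contains a large blow-up of K_k; because of the
    critical edge of F, every vertex has few neighbours in one of its classes, which gives
    a k-colouring of the vertices with o(n^2) monochromatic edges.  In a best such
    colouring, an edge inside of a class has an endpoint that misses linearly many
    neighbours in the other classes but has few in its own; the embeddings of H gained
    from the edges inside of the classes are therefore outnumbered by those lost, and the
    complete k-partite graph on the colour classes has at least as many embeddings of H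
    as G.  Finally, moving a vertex from a larger to a smaller part of a complete
    multipartite graph does not decrease the number of embeddings of a linear forest. *)

Set Implicit Arguments.
Unset Strict Implicit.
Unset Printing Implicit Defensive.
Import Order.TTheory GRing.Theory Num.Theory.

(** * Linear forests in complete multipartite graphs *)

(** Two properties of a linear forest carry the argument. Its vertices can be listed so that all
    edges join consecutive ones; an embedding becomes a sequence built vertex by vertex, with flags
    telling where adjacency is demanded. This one description serves the exact count in multipartite
    graphs, the upper bound by walks and the lower bound for the Turan graph. It is also bipartite,
    so it fits into any two classes, and every missing pair between classes costs a positive
    fraction of n^(h-2) embeddings, h being the number of vertices of H. The obstacle in the walk
    estimate is parity: Motzkin and Straus applied to walk counts yields W_(2l+1) <= alpha W_l^2 +
    o(1), for odd lengths only. An even length is compared with the preceding odd one by passing to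
    very long walks, where the error term has to be kept under control. Everything up to the
    colouring is approximate; only the final comparison of gained and lost embeddings is exact. The
    case k = 1, where alpha = 0, and an edgeless H, whose count says nothing about the edges of G,
    are treated directly. *)

Definition balancing (f : nat -> nat -> nat) : Prop :=
  (forall p q, f p q = f q p) /\ (forall p q, q <= p -> f p.+1 q <= f p q.+1).

Lemma eq_balancing f g : f =2 g -> balancing f -> balancing g.
Proof. by move=> fg [fC fle]; split=> p q *; rewrite -!fg // fle. Qed.

Lemma balancing_const m : balancing (fun _ _ => m).
Proof. by []. Qed.

Lemma balancingD f g :
  balancing f -> balancing g -> balancing (fun p q => f p q + g p q).
Proof.
move=> [fC fle] [gC gle]; split=> p q; first by rewrite fC gC.
by move=> qp; rewrite leq_add ?fle ?gle.
Qed.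

Lemma balancingMl m f : balancing f -> balancing (fun p q => m * f p q).
Proof. by move=> [fC fle]; split=> p q; [rewrite fC | move=> qp; rewrite leq_mul2l fle ?orbT].
Qed.

Lemma balancing_sum (I : finType) (P : pred I) (f : I -> nat -> nat -> nat) :
  (forall i, P i -> balancing (f i)) -> balancing (fun p q => \sum_(i | P i) f i p q).
Proof.
move=> bf; split=> p q *; first by apply: eq_bigr => i /bf [].
by apply: leq_sum => i /bf [_]; apply.
Qed.

(** Here p and q are the sizes of two parts, with p + q fixed, and one vertex is taken from each.
    The factor p * q is itself balancing: p.+1 * q <= p * q.+1 for q <= p. *)
Lemma balancing_edge f :
  balancing f -> balancing (fun p q => p * q * f p.-1 q.-1).
Proof.
move=> [fC fle]; split=> p q; first by rewrite (mulnC p) fC.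
case: p => [|p]; case: q => [|q] //= qp; rewrite ?muln0 ?mul0n //.
by apply: leq_mul; [nia | exact: fle].
Qed.

(* With X = f p q and q < p the inequality reads
   p.+1 * X + q * f p.+1 q.-1 <= p * f p.-1 q.+1 + q.+1 * X,
   where f p.+1 q.-1 <= X <= f p.-1 q.+1. *)
Lemma balancing_vertex f :
  balancing f -> balancing (fun p q => p * f p.-1 q + q * f p q.-1).
Proof.
move=> [fC fle]; split=> p q; first by rewrite addnC (fC p.-1) (fC p).
move=> qp /=.
have [qltp|pleq] := ltnP q p; last first.
  have -> : q = p by apply/eqP; rewrite eqn_leq qp pleq.
  by rewrite addnC (fC p.+1) (fC p.-1).
have le1 : f p q <= f p.-1 q.+1.
  have p_gt0 : 0 < p by apply: leq_ltn_trans qltp.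
  by rewrite -{1}(prednK p_gt0) fle // -ltnS prednK.
have le2 : q * f p.+1 q.-1 <= q * f p q.
  case: q {le1} qp qltp => [|q] qp qltp; first by rewrite !mul0n.
  by rewrite leq_mul2l fle // ltnW.
have le3 : (p - q) * f p q <= (p - q) * f p.-1 q.+1 by rewrite leq_mul2l le1 orbT.
have le4 : q * f p q <= q * f p.-1 q.+1 by rewrite leq_mul2l le1 orbT.
have -> : p * f p.-1 q.+1 = (p - q) * f p.-1 q.+1 + q * f p.-1 q.+1.
  by rewrite -mulnDl subnK.
have -> : p.+1 * f p q = (p - q) * f p q + q.+1 * f p q.
  by rewrite -mulnDl; congr (_ * _); lia.
lia.
Qed.

Section PartCounts.
Variable Q : finType.
Implicit Types (a : Q -> nat) (b : seq bool).

(** Truncation at 0 is harmless: in [part_count] the decreased sizes occur only behind the factor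
    [a c']. *)
Definition decr a c : Q -> nat := fun x => a x - (x == c).

(* The number of ways to choose distinct vertices y_1, .., y_m (m = size b) in a
   complete multipartite graph with part sizes [a], where y_i has to be adjacent to
   its predecessor when the i-th flag of [b] is set, and [c] is the part of the
   predecessor of y_1. *)
Fixpoint part_count b (c : Q) a : nat :=
  if b is d :: b' then
    \sum_(c' | ~~ (d && (c == c'))) a c' * part_count b' c' (decr a c')
  else 1.

Lemma eq_part_count b c a a' : a =1 a' -> part_count b c a = part_count b c a'.
Proof.
elim: b c a a' => //= d b IHb c a a' eqa; apply: eq_bigr => c' _.
by rewrite eqa; congr (_ * _); apply: IHb => x; rewrite /decr eqa.
Qed.

Definition set_parts (i j : Q) a p q : Q -> nat :=
  fun x => if x == i then p else if x == j then q else a x.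

Lemma decr_set_parts_l i j a p q : i != j ->
  decr (set_parts i j a p q) i =1 set_parts i j a p.-1 q.
Proof.
move=> ij x; rewrite /decr /set_parts.
by case: eqVneq => _; rewrite ?subn1 ?subn0.
Qed.

Lemma decr_set_parts_r i j a p q : i != j ->
  decr (set_parts i j a p q) j =1 set_parts i j a p q.-1.
Proof.
move=> ij x; rewrite /decr /set_parts.
case: (eqVneq x i) => [->|_]; first by rewrite (negbTE ij) subn0.
by case: eqVneq => _; rewrite ?subn1 ?subn0.
Qed.

Lemma decr_set_parts i j a p q c : c != i -> c != j ->
  decr (set_parts i j a p q) c =1 set_parts i j (decr a c) p q.
Proof.
move=> ci cj x; rewrite /decr /set_parts.
case: (eqVneq x i) => [->|_]; first by rewrite eq_sym (negbTE ci) subn0.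
by case: (eqVneq x j) => [->|//]; rewrite eq_sym (negbTE cj) subn0.
Qed.

(* [balancing] for the parts i and j holds when the predecessor lies in neither of
   them; otherwise a run of alternating choices from i and j is under way, and the
   count is a sum of a term for runs of even and one for runs of odd length. *)
Definition run_invariant (i j : Q) b : Prop :=
  (forall a c, c != i -> c != j ->
     balancing (fun p q => part_count b c (set_parts i j a p q))) /\
  (forall a, exists A B, [/\ balancing A, balancing B,
     forall p q, part_count b i (set_parts i j a p q) = A p q + q * B p q.-1 &
     forall p q, part_count b j (set_parts i j a p q) = A p q + p * B p.-1 q]).

Lemma set_parts_l i j a p q : set_parts i j a p q i = p.
Proof. by rewrite /set_parts eqxx. Qed.

Lemma set_parts_r i j a p q : i != j -> set_parts i j a p q j = q.
Proof. by rewrite /set_parts eq_sym => /negbTE ->; rewrite eqxx. Qed.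

Definition other_parts i j b (P : pred Q) a p q :=
  \sum_(c' | P c' && (c' != i) && (c' != j))
     a c' * part_count b c' (set_parts i j (decr a c') p q).

Lemma other_partsE i j b P a p q :
  \sum_(c' | P c' && (c' != i) && (c' != j))
     set_parts i j a p q c' * part_count b c' (decr (set_parts i j a p q) c')
  = other_parts i j b P a p q.
Proof.
apply: eq_bigr => c' /andP[/andP[_ ci] cj].
rewrite (eq_part_count _ _ (decr_set_parts a p q ci cj)).
by rewrite {1}/set_parts (negbTE ci) (negbTE cj).
Qed.

Lemma other_parts_balancing i j b P a :
  run_invariant i j b -> balancing (other_parts i j b P a).
Proof.
move=> [IH _]; apply: balancing_sum => c' /andP[/andP[_ ci] cj].
by apply: balancingMl; apply: IH.
Qed.

(** When i and j are both allowed, they contribute p * (A p.-1 q + q * B p.-1 q.-1) + q * (A p q.-1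
    + p * B p.-1 q.-1): this is [balancing_vertex] for A plus twice [balancing_edge] for B. *)
Lemma run_invariant_sum i j b (P : pred Q) a : i != j -> run_invariant i j b ->
  P i -> P j -> balancing (fun p q => \sum_(c' | P c')
    set_parts i j a p q c' * part_count b c' (decr (set_parts i j a p q) c')).
Proof.
move=> ij inv Pi Pj; have [A [B [bA bB Ei Ej]]] := inv.2 a.
have bE := balancingD (balancingD (balancing_vertex bA)
             (balancingMl 2 (balancing_edge bB))) (other_parts_balancing P a inv).
apply: eq_balancing bE => p q.
rewrite [RHS](bigD1 i) //= (bigD1 j) ?Pj 1?eq_sym //= other_partsE.
rewrite set_parts_l set_parts_r //.
rewrite (eq_part_count _ _ (decr_set_parts_l a p q ij)).
rewrite (eq_part_count _ _ (decr_set_parts_r a p q ij)) Ei Ej.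
ring.
Qed.

(** After an unset flag the predecessor is irrelevant, so B = 0. After a set flag with predecessor
    in i, the next vertex comes from j or from a third part; this exchanges the roles of the two
    terms: the new A is p * q * B p.-1 q.-1 plus the other parts, and the new B is the old A. *)
Lemma run_invariantP i j b : i != j -> run_invariant i j b.
Proof.
move=> ij; elim: b => [|d b inv].
  split=> // a; exists (fun _ _ => 1), (fun _ _ => 0).
  by split=> // p q; rewrite /= muln0.
split=> [a c ci cj | a].
  by apply: run_invariant_sum; rewrite ?(negbTE ci) ?(negbTE cj) ?andbF.
case: d => /=; last first.
  exists (fun p q => \sum_c' set_parts i j a p q c' *
     part_count b c' (decr (set_parts i j a p q) c')), (fun _ _ => 0).
  by split; [exact: run_invariant_sum | exact: balancing_const
            | move=> p q; rewrite muln0 addn0 | move=> p q; rewrite muln0 addn0].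
have [A [B [bA bB Ei Ej]]] := inv.2 a.
exists (fun p q => p * q * B p.-1 q.-1 + other_parts i j b predT a p q), A; split=> //.
- exact: balancingD (balancing_edge bB) (other_parts_balancing _ _ inv).
- move=> p q; rewrite (bigD1 j) //= set_parts_r //.
  rewrite (eq_part_count _ _ (decr_set_parts_r a p q ij)) Ej.
  rewrite -other_partsE (eq_bigl (fun c' => true && (c' != i) && (c' != j))).
    by ring.
  by move=> c' /=; rewrite (eq_sym i).
- move=> p q; rewrite (bigD1 i) 1?eq_sym //= set_parts_l.
  rewrite (eq_part_count _ _ (decr_set_parts_l a p q ij)) Ei.
  rewrite -other_partsE (eq_bigl (fun c' => true && (c' != i) && (c' != j))).
    by ring.
  by move=> c' /=; rewrite (eq_sym j) andbC.
Qed.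

Lemma part_count_move i j b c a : i != j -> a j < a i ->
  part_count (false :: b) c a <=
  part_count (false :: b) c (set_parts i j a (a i).-1 (a j).+1).
Proof.
move=> ij aij.
have [_ le] : balancing (fun p q => part_count (false :: b) c (set_parts i j a p q)).
  exact: run_invariant_sum (run_invariantP b ij) _ _.
rewrite (@eq_part_count _ c a (set_parts i j a (a i) (a j))).
  by have := le (a i).-1 (a j); rewrite (ltn_predK aij); apply; rewrite -ltnS (ltn_predK aij).
by move=> x; rewrite /set_parts; case: eqVneq => [->|_] //; case: eqVneq => [->|].
Qed.

(** Induction on the total excess of a over m. If a differs from m, some part i is too large and
    some part j too small, and a j < m j <= m i + 1 <= a i because m is balanced; so a vertex may be
    moved from i to j, which lowers the excess. *)
Lemma part_count_le_balanced b c a m : \sum_x a x = \sum_x m x ->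
  (forall x y, m x <= (m y).+1) ->
  part_count (false :: b) c a <= part_count (false :: b) c m.
Proof.
move=> + mbal; have [N] := ubnP (\sum_x (a x - m x)).
elim: N a => // N IH a ltN suma.
have [i_gt|i_le] := boolP [exists i, m i < a i]; last first.
  have le_am x : true -> a x <= m x.
    by move: i_le; rewrite negb_exists => /forallP/(_ x); rewrite -leqNgt.
  have /eqP : \sum_x a x = \sum_x m x by [].
  rewrite (leqif_sum (fun x lex => leqif_eq (le_am x lex))) => /forallP am.
  by rewrite (@eq_part_count _ c a m) // => x; apply/eqP; apply: am.
have [i mi] := existsP i_gt.
have /existsP[j mj] : [exists j, a j < m j].
  rewrite -[[exists _, _]]negbK negb_exists; apply/negP => /forallP le_ma.
  have le_ma' x : true -> m x <= a x by move=> _; have := le_ma x; rewrite -leqNgt.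
  have /eqP : \sum_x m x = \sum_x a x by [].
  rewrite (leqif_sum (fun x lex => leqif_eq (le_ma' x lex))) => /forallP/(_ i).
  by rewrite /= => /eqP am; rewrite am ltnn in mi.
have ij : i != j by apply: contraTneq mi => ->; rewrite -leqNgt ltnW.
have ji : j != i by rewrite eq_sym.
have aij : a j < a i by have := mbal j i; lia.
have splitij (f : Q -> nat) :
  \sum_x f x = f i + (f j + \sum_(x | (x != i) && (x != j)) f x).
  by rewrite (bigD1 i) //= (bigD1 j).
have eq_rest (g : Q -> nat -> nat) :
  \sum_(x | (x != i) && (x != j)) g x (set_parts i j a (a i).-1 (a j).+1 x)
  = \sum_(x | (x != i) && (x != j)) g x (a x).
  by apply: eq_bigr => x /andP[xi xj]; rewrite /set_parts (negbTE xi) (negbTE xj).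
apply: leq_trans (part_count_move b c ij aij) _; apply: IH.
- move: ltN; rewrite !splitij set_parts_l set_parts_r //.
  by rewrite (eq_rest (fun x y => y - m x)); lia.
- rewrite -suma !splitij set_parts_l set_parts_r // (eq_rest (fun _ y => y)).
  by move: (\sum_(_ | _) _) => z; lia.
Qed.

End PartCounts.

(** * Embeddings as sequences of vertices *)

Definition embr (VH V : finType) (H : {set {set VH}}) (e : rel V) : {set {ffun VH -> V}} :=
  [set f : {ffun VH -> V} | injectiveb f &&
     [forall x, forall y, ([set x; y] \in H) ==> e (f x) (f y)]].

Lemma embrP (VH V : finType) (H : {set {set VH}}) (e : rel V) (f : {ffun VH -> V}) :
  reflect (injective f /\ forall x y, [set x; y] \in H -> e (f x) (f y))
          (f \in embr H e).
Proof.
rewrite inE; apply: (iffP andP) => [[/injectiveP fi /forallP fe]|[fi fe]]; split=> //.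
- by move=> x y xy; have /forallP/(_ y)/implyP := fe x; apply.
- exact/injectiveP.
- by apply/forallP => x; apply/forallP => y; apply/implyP; apply: fe.
Qed.

Lemma sgraph_edge (V : finType) (E : {set {set V}}) A : sgraph E -> A \in E ->
  exists x y, x != y /\ A = [set x; y].
Proof.
move=> /forallP/(_ A)/implyP sE AE.
by apply/cards2P; apply: sE.
Qed.

Lemma gadj_sym (V : finType) (E : {set {set V}}) : symmetric (gadj E).
Proof. by move=> x y; rewrite /gadj setUC. Qed.

Lemma gadj_irr (V : finType) (E : {set {set V}}) : sgraph E -> irreflexive (gadj E).
Proof.
move=> sE x; apply: contraTF sE => xE; rewrite /sgraph negb_forall.
by apply/existsP; exists [set x; x]; rewrite -/(gadj E x x) xE setUid cards1.
Qed.

(** From here on host graphs are relations, so that the complete multipartite graph of a colouring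
    is simply [phi u != phi w]. *)
Lemma embeddingsE (VH V : finType) (H : {set {set VH}}) (G : {set {set V}}) :
  sgraph H -> embeddings H G = embr H (gadj G).
Proof.
move=> sH; apply/setP => f; rewrite !inE; congr (_ && _).
apply/forallP/forallP => [fH x|fH A].
  apply/forallP => y; apply/implyP => xy.
  by have /implyP/(_ xy) := fH [set x; y]; rewrite imsetU !imset_set1.
apply/implyP => AH; have [x [y [_ eA]]] := sgraph_edge sH AH.
have /forallP/(_ y) := fH x; rewrite -eA AH /= /gadj.
by rewrite eA imsetU !imset_set1.
Qed.

Lemma card_tuple_cons (V : finType) n (P : pred (seq V)) :
  #|[set t : n.+1.-tuple V | P t]| = \sum_y #|[set t : n.-tuple V | P (y :: t)]|.
Proof.
rewrite -sum1dep_card (partition_big (@thead n V) predT) //=.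
apply: eq_bigr => y _; rewrite -sum1dep_card.
rewrite (reindex_onto (fun t : n.-tuple V => [tuple of y :: t]) (fun t => [tuple of behead t])) /=.
  by apply: eq_bigl => t; rewrite theadE eqxx andbT -val_eqE /= eqxx andbT.
by move=> t /andP[_ /eqP <-]; rewrite [t in RHS]tuple_eta.
Qed.

Section SeqCount.
Variables (V : finType) (e : rel V).

(* The flags are those of [part_count]; [v] is the predecessor of the first vertex and
   [U] the set of vertices already used. *)
Fixpoint seq_count (b : seq bool) (v : V) (U : {set V}) : nat :=
  if b is d :: b' then
    \sum_(y | (y \notin U) && (d ==> e v y)) seq_count b' y (y |: U)
  else 1.

Fixpoint flagged (b : seq bool) (v : V) (U : {set V}) (s : seq V) : bool :=
  match b, s with
  | [::], [::] => true
  | d :: b', y :: s' => [&& y \notin U, d ==> e v y & flagged b' y (y |: U) s']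
  | _, _ => false
  end.

Lemma card_flagged n b v U : size b = n ->
  #|[set t : n.-tuple V | flagged b v U t]| = seq_count b v U.
Proof.
elim: b n v U => [|d b IH] [|n] v U //= => [_|[sb]].
  rewrite (_ : [set _ | _] = setT) ?cardsT ?card_tuple ?expn0 //.
  by apply/setP => t; rewrite !inE tuple0.
rewrite (card_tuple_cons n (flagged (d :: b) v U)) /= [RHS]big_mkcond.
apply: eq_bigr => y _; case: ifP => [/andP[yU dy]|/nandP yUd].
  by rewrite -(IH n) //; apply: eq_card => t; rewrite !inE yU dy.
by apply: eq_card0 => t; rewrite !inE; case: yUd => /negbTE ->; rewrite ?andbF.
Qed.

Lemma flagged_map (VH : finType) (r : rel VH) (f : VH -> V) x s U :
  flagged (pairmap r x s) (f x) U (map f s) =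
  [&& all (fun y => y \notin U) (map f s), uniq (map f s)
    & path (fun y z => r y z ==> e (f y) (f z)) x s].
Proof.
elim: s x U => //= y s IH x U; rewrite IH.
have -> : all (fun z => z \notin f y |: U) (map f s) =
          (f y \notin map f s) && all (fun z => z \notin U) (map f s).
  elim: (map f s) => //= z l ->; rewrite !inE negb_or [z == _]eq_sym negb_or.
  by do !case: (_ \notin _); case: (_ == _); rewrite ?andbF.
by do !case: (_ \notin _); case: (_ ==> _); rewrite ?andbF ?andbT /= ?andbF ?andbT //;
  case: (all _ _); case: (uniq _); rewrite ?andbF ?andbT.
Qed.

End SeqCount.

(** Along the list x :: s every edge of H joins neighbours in the list, so adjacency has to be
    checked only between consecutive images. The first flag is [false]: the first vertex has no
    predecessor, and v is a dummy. *)
Lemma card_embr (VH V : finType) (H : {set {set VH}}) (e : rel V) x s v :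
  symmetric e -> uniq (x :: s) -> (forall z, z \in x :: s) ->
  (forall y z, [set y; z] \in H -> index z (x :: s) = (index y (x :: s)).+1 \/
                                   index y (x :: s) = (index z (x :: s)).+1) ->
  #|embr H e| = seq_count e (false :: pairmap (gadj H) x s) v set0.
Proof.
move=> esym us alls adjs; set n := (size s).+1.
have szf (f : VH -> V) : size (map f (x :: s)) == n by rewrite size_map.
pose tof (f : {ffun VH -> V}) : n.-tuple V := Tuple (szf f).
have tofE f : flagged e (false :: pairmap (gadj H) x s) v set0 (tof f) = (f \in embr H e).
  rewrite /= in_set0 /= flagged_map inE.
  rewrite (_ : injectiveb f = uniq (map f (x :: s))); last first.
    rewrite /injectiveb /dinjectiveb; apply/perm_uniq/perm_map/uniq_perm => //.
      exact: enum_uniq.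
    by move=> z; rewrite alls mem_enum.
  rewrite /= (_ : all _ _ = (f x \notin map f s)); last first.
    by elim: (map f s) => //= z l ->; rewrite !inE orbF negb_or eq_sym.
  rewrite -andbA; congr (_ && (_ && _)).
  apply/(pathP x)/forallP => [pe y|fe i lti].
    apply/forallP => z; apply/implyP => yz.
    have key a b : [set a; b] \in H -> index b (x :: s) = (index a (x :: s)).+1 ->
                   e (f a) (f b).
      move=> ab ib; have lti : index a (x :: s) < size s.
        by rewrite -ltnS -ib -[X in _ < X]/(size (x :: s)) index_mem.
      have := pe _ lti; rewrite nth_index //.
      have -> : nth x s (index a (x :: s)) = b.
        by rewrite -[RHS](nth_index x (alls b)) ib.
      by rewrite /gadj ab.
    by case: (adjs y z yz) => [|iy]; [exact: key | rewrite esym; apply: key; rewrite // setUC].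
  by have /forallP/(_ (nth x s i)) := fe (nth x (x :: s) i).
have szb : size (false :: pairmap (gadj H) x s) = n by rewrite /= size_pairmap.
rewrite -(card_flagged e v set0 szb).
rewrite -(card_in_imset (f := tof) (D := mem (embr H e))); last first.
  move=> f g _ _ /(congr1 val)/= [fgx /eq_in_map fgs]; apply/ffunP => z.
  by have := alls z; rewrite inE => /predU1P[->|/fgs].
apply: eq_card => t; rewrite inE; apply/imsetP/idP => [[f fe ->]|ft].
  by rewrite (tofE f).
pose f := [ffun z => nth v t (index z (x :: s))].
have tE : t = tof f.
  apply: val_inj; apply: (@eq_from_nth _ v) => [|i]; rewrite size_tuple ?size_map // => lti.
  rewrite /= -[f x :: _]/(map f (x :: s)) (nth_map x) ?size_map //.
  by rewrite ffunE index_uniq.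
by exists f => //; rewrite -tofE -tE.
Qed.

Section Multipartite.
Variables (V Q : finType) (phi : V -> Q).

Lemma seq_count_multipartite b v U :
  seq_count (fun u w => phi u != phi w) b v U =
  part_count b (phi v) (fun c => #|[set u | (phi u == c) && (u \notin U)]|).
Proof.
elim: b v U => //= d b IH v U.
rewrite (partition_big phi (fun c => ~~ (d && (phi v == c)))) /=; last first.
  by move=> y /andP[_]; case: d => //=.
apply: eq_bigr => c dc.
rewrite (eq_bigr (fun=> part_count b c
   (decr (fun c => #|[set u | (phi u == c) && (u \notin U)]|) c))); last first.
  move=> y /andP[/andP[yU _] /eqP <-]; rewrite IH; apply: eq_part_count => c'.
  rewrite /decr [in RHS](cardsD1 y) !inE yU andbT [phi y == c']eq_sym addKn.
  by apply: eq_card => z; rewrite !inE negb_or andbCA.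
rewrite sum_nat_const; congr (_ * _); apply: eq_card => y; rewrite !inE.
rewrite -[LHS]/((y \notin U) && (d ==> (phi v != phi y)) && (phi y == c)).
case: (eqVneq (phi y) c) => [->|]; rewrite ?andbF //= andbT.
by case: d dc => /= [->|_]; rewrite andbT.
Qed.

End Multipartite.

(** The paths are appended one after the other. The list s built so far is closed under adjacency,
    so the component of a vertex outside of s is disjoint from s and no edge joins the two. *)
Lemma linear_forest_enum (V : finType) (H : {set {set V}}) : linear_forest H ->
  exists s : seq V, [/\ uniq s, forall z, z \in s &
    forall y z, [set y; z] \in H ->
      index z s = (index y s).+1 \/ index y s = (index z s).+1].
Proof.
move=> [sH pathH].
suff extend m (s : seq V) : #|[set z | z \notin s]| <= m -> uniq s ->
    (forall y z, [set y; z] \in H -> y \in s -> z \in s) ->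
    (forall y z, [set y; z] \in H -> y \in s ->
      index z s = (index y s).+1 \/ index y s = (index z s).+1) ->
  exists s : seq V, [/\ uniq s, forall z, z \in s &
    forall y z, [set y; z] \in H ->
      index z s = (index y s).+1 \/ index y s = (index z s).+1].
  by apply: (extend _ [::] (leqnn _)).
elim: m s => [|m IH] s lem us closeds adjs.
  have alls z : z \in s.
    move: lem; rewrite leqn0 cards_eq0 => /eqP/setP/(_ z).
    by rewrite !inE => /negbFE.
  by exists s; split=> // y z yz; apply: adjs.
have [/forallP alls|] := boolP [forall z, z \in s].
  by exists s; split=> // y z yz; apply: adjs.
rewrite negb_forall => /existsP[v vs].
have [g [gi gC gadj']] := pathH v; set C := component H v in g gi gC gadj'.
have symH : connect_sym (gadj H) by apply: sym_connect_sym; apply: gadj_sym.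
have vC : v \in C by rewrite inE.
have gon z : z \in C -> exists i, z = g i.
  move=> zC; have : z \in g @: setT.
    suff -> : g @: setT = C by [].
    apply/eqP; rewrite eqEcard; apply/andP; split.
      by apply/subsetP => _ /imsetP[i _ ->].
    by rewrite card_imset // cardsT card_ord.
  by case/imsetP => i _ ->; exists i.
have Cs z : z \in C -> z \notin s.
  rewrite inE => /connectP[p pp zp]; apply: contra vs; rewrite zp.
  elim/last_ind: p z pp zp => [|p w IHp] z //; rewrite rcons_path last_rcons => /andP[pp pw] _ ws.
  by apply: (IHp (last v p)) => //; apply: closeds ws; rewrite setUC.
have Cclosed y z : [set y; z] \in H -> y \in C -> z \in C.
  by rewrite !inE => yz vy; apply: connect_trans vy (connect1 _).
set p := map g (enum 'I_#|C|).
have memp z : (z \in p) = (z \in C).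
  apply/mapP/idP => [[i _ ->]//|/gon[i ->]]; by exists i; rewrite ?mem_enum.
have idxp i : index (g i) p = i by rewrite index_map // index_enum_ord.
apply: (IH (s ++ p)).
- rewrite -ltnS; apply: leq_trans lem; apply: proper_card.
  rewrite properE; apply/andP; split.
    by apply/subsetP => z; rewrite !inE mem_cat negb_or => /andP[].
  by apply/subsetPn; exists v; rewrite !inE ?mem_cat ?negb_or ?memp ?vC ?andbF.
- rewrite cat_uniq us map_inj_uniq // enum_uniq andbT /=.
  by apply/hasPn => z; rewrite memp; apply: Cs.
- move=> y z yz; rewrite !mem_cat !memp => /orP[ys|yC].
    by rewrite (closeds y).
  by rewrite (Cclosed y) ?orbT.
- move=> y z yz; rewrite mem_cat memp => /orP[ys|yC].
    by rewrite !index_cat ys (closeds _ _ yz ys); apply: adjs.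
  have zC := Cclosed _ _ yz yC.
  rewrite !index_cat (negbTE (Cs _ yC)) (negbTE (Cs _ zC)).
  have [i yi] := gon _ yC; have [j zj] := gon _ zC.
  move: yz; rewrite yi zj gadj' !idxp => /orP[] /eqP ij; [left|right]; lia.
Qed.

Lemma card_turan_part n k (c : 'I_k) :
  n %/ k <= #|[set i : 'I_n | i %% k == c]| <= (n %/ k).+1.
Proof.
have k_gt0 : 0 < k by apply: leq_ltn_trans (ltn_ord c).
apply/andP; split.
  have lt_n (q : 'I_(n %/ k)) : q * k + c < n.
    have := ltn_ord q; have := ltn_ord c; have := leq_divM n k; nia.
  pose g q := Ordinal (lt_n q).
  have gi : injective g.
    move=> q q' /(congr1 val) /= /eqP; rewrite eqn_add2r eqn_pmul2r // => /eqP qq.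
    exact: val_inj.
  rewrite -[X in X <= _](card_ord (n %/ k)) -(card_imset predT gi).
  apply: subset_leq_card; apply/subsetP => _ /imsetP[q _ ->].
  by rewrite inE /= modnMDl modn_small.
have lt_d (i : 'I_n) : i %/ k < (n %/ k).+1 by rewrite ltnS leq_div2r // ltnW.
pose g i := Ordinal (lt_d i).
have gi : {in [set i : 'I_n | i %% k == c] &, injective g}.
  move=> i j; rewrite !inE => /eqP ic /eqP jc [gij].
  by apply: val_inj; rewrite /= (divn_eq i k) (divn_eq j k) gij ic jc.
by rewrite -(card_in_imset gi) -[X in _ <= X]card_ord max_card.
Qed.

Lemma card_embr_multipartite_le_turan (VH : finType) (H : {set {set VH}}) n k
    (phi : 'I_n -> 'I_k) : linear_forest H ->
  #|embr H (fun u w => phi u != phi w)| <=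
  #|embr H (fun u w : 'I_n => u %% k != w %% k)|.
Proof.
move=> lfH; have [s [us alls adjs]] := linear_forest_enum lfH.
case: s us alls adjs => [|x s] us alls adjs.
  apply: subset_leq_card; apply/subsetP => f /embrP[fi _]; apply/embrP; split=> // x.
  by have := alls x.
case: n phi => [|n] phi.
  by rewrite (eq_card (B := mem set0)) ?cards0 // => f; have := ltn_ord (f x).
have k_gt0 : 0 < k by apply: leq_ltn_trans (ltn_ord (phi ord0)).
pose tau (i : 'I_n.+1) : 'I_k := Ordinal (ltn_pmod i k_gt0).
rewrite -[X in _ <= X]/(#|embr H (fun u w => tau u != tau w)|).
rewrite !(card_embr ord0 _ us alls adjs) ?seq_count_multipartite;
  try by move=> u w; rewrite eq_sym.
(* The leading flag is [false], so the part of the dummy predecessor can be replaced by any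
   other. *)
have -> c : part_count (false :: pairmap (gadj H) x s) (phi ord0) c =
            part_count (false :: pairmap (gadj H) x s) (tau ord0) c by [].
have sizeE (psi : 'I_n.+1 -> 'I_k) :
  \sum_c #|[set u | (psi u == c) && (u \notin set0)]| = n.+1.
  rewrite -[RHS]card_ord -sum1_card (partition_big psi predT) //=.
  by apply: eq_bigr => c _; rewrite sum1dep_card; apply: eq_card => u; rewrite !inE andbT.
apply: part_count_le_balanced => [|c d]; first by rewrite !sizeE.
have tauE (a : 'I_k) :
  #|[set u | (tau u == a) && (u \notin set0)]| = #|[set i : 'I_n.+1 | i %% k == a]|.
  by apply: eq_card => i; rewrite !inE andbT.
rewrite !tauE; have /andP[_ le1] := card_turan_part n.+1 c.
by have /andP[le2 _] := card_turan_part n.+1 d; apply: leq_trans le1 _.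
Qed.

(** * Blow-ups of cliques and the inequality of Motzkin and Straus *)

Definition nbhd (V : finType) (e : rel V) (v : V) : {set V} := [set u | e v u].

Definition common_nbhd (V : finType) (e : rel V) (Y : {set V}) : {set V} :=
  [set u | [forall v in Y, e v u]].

(** Cliques are counted as ordered tuples, chosen by successively shrinking the common
    neighbourhood. *)
Fixpoint clique_count (V : finType) (e : rel V) (r : nat) (A : {set V}) : nat :=
  if r is r'.+1 then \sum_(u in A) clique_count e r' (A :&: nbhd e u) else 1.

Lemma clique_count_le (V : finType) (e : rel V) r A :
  clique_count e r A <= #|V| ^ r.
Proof.
elim: r A => //= r IH A; rewrite expnS.
apply: (@leq_trans (\sum_(u in A) #|V| ^ r)); first by apply: leq_sum => u _.
by rewrite sum_nat_const leq_mul2r max_card orbT.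
Qed.

(** The left side counts a clique once for each of its common neighbours in X. If there are at most
    q of them, the term q * n^r pays for it; otherwise they form a set Y with more than q elements
    whose common neighbourhood contains the clique, and the clique is counted at most |X| times. *)
Lemma clique_count_pigeonhole (V : finType) (e : rel V) r q (A X : {set V}) :
  \sum_(v in X) clique_count e r (A :&: nbhd e v) <=
  q * #|V| ^ r +
  #|X| * \sum_(Y : {set V} | (Y \subset X) && (q < #|Y|))
            clique_count e r (A :&: common_nbhd e Y).
Proof.
elim: r A X => [|r IH] A X /=.
  rewrite sum_nat_const !muln1; have [//|qX] := leqP #|X| q; first by lia.
  rewrite (bigD1 X) /= ?subxx //; nia.
rewrite (exchange_big_dep (mem A)) /=; last by move=> v u _; rewrite inE => /andP[].
have step u : u \in A ->
   \sum_(v in X | u \in A :&: nbhd e v) clique_count e r (A :&: nbhd e v :&: nbhd e u)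
   <= q * #|V| ^ r + #|X| * \sum_(Y : {set V} | [&& Y \subset X, q < #|Y| & u \in common_nbhd e Y])
            clique_count e r (A :&: common_nbhd e Y :&: nbhd e u).
  move=> uA; pose Xu := [set v in X | e v u].
  rewrite (eq_big (mem Xu) (fun v => clique_count e r (A :&: nbhd e u :&: nbhd e v))); last first.
  - by move=> v _; rewrite setIAC.
  - by move=> v; rewrite !inE uA.
  apply: leq_trans (IH _ _) _; rewrite leq_add2l; apply: leq_mul.
    by apply: subset_leq_card; apply/subsetP => v; rewrite inE => /andP[].
  rewrite [leqLHS](eq_bigr (fun Y => clique_count e r (A :&: common_nbhd e Y :&: nbhd e u)));
    last by move=> Y _; rewrite setIAC.
  rewrite [leqLHS]big_mkcond [leqRHS]big_mkcond /=; apply: leq_sum => Y _.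
  case: ifP => // /andP[/subsetP YX ->].
  rewrite ifT //; apply/andP; split.
    by apply/subsetP => v /YX; rewrite inE => /andP[].
  by rewrite inE; apply/forallP => v; apply/implyP => /YX; rewrite inE => /andP[].
apply: leq_trans (leq_sum _ step) _.
rewrite big_split /= sum_nat_const -big_distrr /=; apply: leq_add.
  by rewrite mulnCA expnS leq_mul2l leq_mul2r max_card !orbT.
rewrite leq_mul2l; apply/orP; right.
rewrite (exchange_big_dep (fun Y : {set V} => (Y \subset X) && (q < #|Y|))) /=; last first.
  by move=> u Y _ /and3P[-> ->].
apply: leq_sum => Y /andP[YX qY]; rewrite YX qY /=.
by apply: eq_leq; apply: eq_bigl => u; rewrite in_setI.
Qed.

Definition complete_blowup (V : finType) (e : rel V) r T (A : {set V}) (S : nat -> {set V}) :=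
  (forall i, i < r -> S i \subset A /\ #|S i| = T) /\
  (forall i j, i < j < r -> forall u w, u \in S i -> w \in S j -> e u w).

Lemma exists_subset_card (V : finType) (A : {set V}) m : m <= #|A| ->
  exists2 B : {set V}, B \subset A & #|B| = m.
Proof.
move=> mA; exists [set x in take m (enum A)].
  by apply/subsetP => x; rewrite inE => /mem_take; rewrite mem_enum.
by rewrite cardsE (card_uniqP (take_uniq _ (enum_uniq _))) size_takel // -cardE.
Qed.

(** A positive density of cliques yields blow-ups, by induction on r: a constant number of vertices
    lying in many cliques is fixed, more than T of them share a positive density of r-cliques in
    their common neighbourhood, and they contain the new class. *)
Lemma blowup_of_clique_count r T D : exists n0, forall (V : finType) (e : rel V) (A : {set V}),
  n0 <= #|V| -> #|V| ^ r <= D * clique_count e r A ->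
  exists S, complete_blowup e r T A S.
Proof.
elim: r D => [|r IH] D.
  by exists 0 => V e A _ _; exists (fun=> set0); split=> // i j; rewrite ltn0 andbF.
(* Each of the m vertices lies in at least n^r / (2 D) cliques, which makes 2 * T.+1 * n^r
   incidences, twice what the pigeonhole with q = T.+1 gives away. The factor 2 ^ m accounts for the
   choice of Y among the subsets of X. *)
pose m := 4 * D * T.+1; have [n0 IHn] := IH (m * 2 ^ m).
exists (n0 + 2 * D * m + 1) => V e A nV; set n := #|V| => ltD /=.
pose X0 := [set u in A | n ^ r <= 2 * D * clique_count e r (A :&: nbhd e u)].
have n_gt0 : 0 < n ^ r by rewrite expn_gt0; lia.
have D_gt0 : 0 < D 
  by rewrite lt0n; apply: contraTneq ltD => ->; rewrite mul0n leqn0 expn_eq0; lia.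
have X0large : n <= 2 * D * #|X0|.
  have : D * clique_count e r.+1 A * 2 <= (2 * D * #|X0| + n) * n ^ r.
    rewrite /= big_distrr big_distrl /= mulnDl.
    apply: (@leq_trans (\sum_(u in A) ((u \in X0) * (2 * D * n ^ r) + n ^ r))).
      apply: leq_sum => u uA; rewrite inE uA /=; case: (leqP (n ^ r)) => leu /=.
        have := clique_count_le e r (A :&: nbhd e u); rewrite -/n; nia.
      by rewrite mul0n add0n mulnAC [D * 2]mulnC ltnW.
    rewrite big_split /= -big_distrl /= sum_nat_const leq_add ?leq_mul2r ?max_card ?orbT //.
    have : \sum_(u in A) (u \in X0) <= #|X0|.
      rewrite -sum1_card [leqRHS]big_mkcond [leqLHS]big_mkcond.
      by apply: leq_sum => u _; do 2!case: (u \in _).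
    move=> leX; rewrite (mulnAC _ #|X0|) [leqRHS]mulnC.
    by rewrite leq_mul2r leX orbT.
  move: ltD; rewrite expnS => le1 le2.
  have : n * 2 * n ^ r <= (2 * D * #|X0| + n) * n ^ r by lia.
  by rewrite leq_pmul2r //; lia.
have [X XX0 cX] : exists2 X : {set V}, X \subset X0 & #|X| = m.
  apply: exists_subset_card; rewrite -(@leq_pmul2l (2 * D)) ?muln_gt0 //; lia.
have sumX : 2 * T.+1 * n ^ r <= \sum_(v in X) clique_count e r (A :&: nbhd e v).
  rewrite -(@leq_pmul2l (2 * D)) ?muln_gt0 // big_distrr /=.
  apply: (@leq_trans (\sum_(v in X) n ^ r)).
    by rewrite sum_nat_const cX /m; nia.
  by apply: leq_sum => v /(subsetP XX0); rewrite inE => /andP[].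
have : T.+1 * n ^ r <= m * \sum_(Y : {set V} | (Y \subset X) && (T.+1 < #|Y|))
            clique_count e r (A :&: common_nbhd e Y).
  by have := clique_count_pigeonhole e r T.+1 A X; rewrite cX -/n; nia.
move=> leY.
have [Y /andP[YX TY] leK] : exists2 Y : {set V}, (Y \subset X) && (T.+1 < #|Y|) &
   n ^ r <= m * 2 ^ m * clique_count e r (A :&: common_nbhd e Y).
  apply/exists_inP; apply: contraTT isT => /exists_inPn noY.
  have : 2 ^ m * (m * \sum_(Y : {set V} | (Y \subset X) && (T.+1 < #|Y|))
            clique_count e r (A :&: common_nbhd e Y)) <= 2 ^ m * (n ^ r).-1.
    rewrite mulnA [2 ^ m * m]mulnC big_distrr /=.
    apply: (@leq_trans (\sum_(Y : {set V} | Y \in powerset X) (n ^ r).-1)).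
      rewrite [leqLHS]big_mkcond [leqRHS]big_mkcond /=; apply: leq_sum => Y _.
      case: ifP => // YXT; rewrite powersetE; have /andP[-> _] := YXT.
      by have := noY Y YXT; lia.
    by rewrite sum_nat_const card_powerset cX.
  rewrite leq_pmul2l ?expn_gt0 //; nia.
have [|S [S1 S2]] := IHn V e (A :&: common_nbhd e Y) _ leK; first by rewrite -/n; lia.
have [Z ZY cZ] := @exists_subset_card _ Y T (ltnW (ltnW TY)).
exists (fun i => if i is i'.+1 then S i' else Z); split.
  case=> [_|i /S1[SA cS]]; split=> //.
    apply: subset_trans ZY (subset_trans YX (subset_trans XX0 _)).
    by apply/subsetP => u; rewrite inE => /andP[].
  exact: subset_trans SA (subsetIl _ _).
move=> [|i] [|j] //= ij u w uS wS; last by apply: (S2 i j).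
have [/subsetP/(_ w wS)] := S1 j ij.
rewrite !inE => /andP[_ /forallP/(_ u)/implyP] uw _; apply: uw.
exact: (subsetP ZY).
Qed.

Local Open Scope ring_scope.

(** * Weighted quadratic forms *)

Lemma rat_nat_bound (x : rat) : exists m : nat, x <= m%:R.
Proof.
have [x0|x0] := leP 0 x; last by exists 0%N; apply: ltW.
by exists (Num.Def.archi_bound x); apply/ltW/archi_boundP.
Qed.

Definition qform (V : finType) (e : rel V) (A : {set V}) (x : V -> rat) : rat :=
  \sum_(u in A) \sum_(w in A :&: nbhd e u) x u * x w.

Section QuadraticForm.
Variables (V : finType) (e : rel V) (x : V -> rat).
Hypotheses (esym : symmetric e) (x01 : forall u, 0 <= x u <= 1).
Implicit Types A B : {set V}.

Let x0 u : 0 <= x u. Proof. by have /andP[] := x01 u. Qed.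
Let x1 u : x u <= 1. Proof. by have /andP[] := x01 u. Qed.

Lemma sum_weight_ge0 A : 0 <= \sum_(u in A) x u.
Proof. by apply: sumr_ge0 => u _. Qed.

Lemma sum_weight_le A : \sum_(u in A) x u <= #|A|%:R.
Proof. by rewrite -sum1_card natr_sum; apply: ler_sum => u _. Qed.

Lemma sum_weight_leV A : \sum_(u in A) x u <= #|V|%:R.
Proof. by apply: le_trans (sum_weight_le A) _; rewrite ler_nat max_card. Qed.

Lemma qformE A : qform e A x = \sum_(u in A) x u * \sum_(w in A :&: nbhd e u) x w.
Proof. by apply: eq_bigr => u _; rewrite mulr_sumr. Qed.

Lemma qform_le_card A : qform e A x <= (clique_count e 2 A)%:R.
Proof.
rewrite /= natr_sum; apply: ler_sum => u _; rewrite sum1_card -sum1_card natr_sum.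
by apply: ler_sum => w _; rewrite -[1%:R]mulr1; apply: ler_pM.
Qed.

(** A pair that is not inside of B has an end in A \ B and is charged to it. Pairs with both ends
    there are counted twice on the right, hence the inequality. *)
Lemma qform_split A B : B \subset A ->
  qform e A x <= qform e B x +
    (\sum_(u in A :\: B) x u * \sum_(w in A :&: nbhd e u) x w) *+ 2.
Proof.
move=> BA; have BE : A :&: B = B by apply/setIidPr.
rewrite qformE (big_setID B) /= BE mulr2n addrA lerD2r.
have -> : \sum_(u in B) x u * \sum_(w in A :&: nbhd e u) x w =
  qform e B x + \sum_(u in B) \sum_(w in (A :\: B) :&: nbhd e u) x u * x w.
  rewrite -big_split; apply: eq_bigr => u _ /=.
  rewrite -!mulr_sumr -mulrDr (big_setID B) /=; congr (_ * (_ + _)); apply: eq_bigl => w.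
    rewrite !inE; case wB: (w \in B); rewrite ?andbF // (subsetP BA) //.
    by rewrite andbT.
  by rewrite !inE andbA.
rewrite lerD2l (exchange_big_dep (mem (A :\: B))) /=; last by move=> u w _; rewrite inE => /andP[].
apply: ler_sum => w wAB; rewrite -mulr_suml mulrC ler_wpM2l //.
rewrite [leLHS]big_mkcond [leRHS]big_mkcond; apply: ler_sum => u _.
case: ifP => [|_]; last by case: ifP.
move=> /andP[uB]; rewrite !inE => /andP[_ euw]; rewrite (subsetP BA) // esym.
by rewrite euw.
Qed.

End QuadraticForm.

(* Induction on [r] as in Turan's theorem: with v a vertex of maximum weighted degree
   D and S the total weight, the form is at most (1 - 1/r) D^2 + 2 (S - D) D.
   Few vertices lie in many copies of K_{r+2}; they are excluded from the choice of v. *)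
Lemma motzkin_straus_approx r (delta : rat) : 0 < delta ->
  exists D : nat, forall (V : finType) (e : rel V) (A : {set V}) (x : V -> rat),
    symmetric e -> (forall u, 0 <= x u <= 1) ->
    (D * clique_count e r.+2 A <= #|V| ^ r.+2)%N ->
    qform e A x <= (1 - r.+1%:R^-1) * (\sum_(u in A) x u) ^+ 2 + delta * #|V|%:R ^+ 2.
Proof.
elim: r delta => [|r IH] delta delta_gt0.
  have [D leD] := rat_nat_bound delta^-1; exists D => V e A x esym x01 leK.
  rewrite invr1 subrr mul0r add0r; apply: le_trans (qform_le_card e x01 A) _.
  have : (D * clique_count e 2 A)%:R <= (#|V| ^ 2)%:R :> rat by rewrite ler_nat.
  rewrite natrM natrX => leDK; rewrite mulrC -ler_pdivrMr // mulrC.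
  by apply: le_trans leDK; rewrite ler_wpM2r.
have [|D' IHD] := IH (delta / 2); first lra.
(* Half of delta is for the induction hypothesis; the bad vertices cost delta / 4, and their
   contribution enters twice. *)
have [m lem] := rat_nat_bound (4 / delta).
exists (D' * m)%N => V e A x esym x01 leK; set n := #|V| in leK *.
set N : rat := n%:R; have N_ge0 : 0 <= N by rewrite ler0n.
have x0 u : 0 <= x u by have /andP[] := x01 u.
have x1 u : x u <= 1 by have /andP[] := x01 u.
pose Bad := [set v in A | (n ^ r.+2 < D' * clique_count e r.+2 (A :&: nbhd e v))%N].
have leBad : #|Bad|%:R <= delta / 4 * N.
  have le1 : (#|Bad| * n ^ r.+2 <= D' * clique_count e r.+3 A)%N.
    rewrite -[clique_count e r.+3 A]/(\sum_(u in A) clique_count e r.+2 (A :&: nbhd e u))%N.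
    rewrite big_distrr -sum_nat_const /= [leqLHS]big_mkcond [leqRHS]big_mkcond.
    by apply: leq_sum => u _; rewrite inE; case: (u \in A) => //=; case: ltnP => // /ltnW.
  have le2 : (m * #|Bad| <= n)%N.
    have [n0|n_gt0] := posnP n.
      by have := max_card (mem Bad); rewrite -/n n0 leqn0 => /eqP ->; rewrite muln0.
    rewrite -(@leq_pmul2r (n ^ r.+2)) ?expn_gt0 ?n_gt0 // -expnS.
    apply: leq_trans leK.
    by rewrite -[leqLHS]mulnA [leqRHS]mulnAC [leqRHS]mulnC leq_mul2l le1 orbT.
  have : (m * #|Bad|)%:R <= N by rewrite ler_nat.
  rewrite natrM => le3; rewrite mulrC -ler_pdivrMr ?divr_gt0 // mulrC invf_div.
  by apply: le_trans le3; rewrite ler_wpM2r.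
pose d u := \sum_(w in A :&: nbhd e u) x w.
have d_le u : d u <= N by apply: sum_weight_leV.
have d_ge0 u : 0 <= d u by apply: sum_weight_ge0.
pose S := \sum_(u in A) x u.
have S_ge0 : 0 <= S by apply: sum_weight_ge0.
have c_ge0 : 0 <= 1 - r.+2%:R^-1 :> rat by rewrite subr_ge0 invf_le1 ?ler1n ?ltr0n.
(* If all vertices of A are bad, then A is so small that the trivial bound |A| * n is enough. *)
have [|[v0 v0G]] := set_0Vmem (A :\: Bad).
  move/eqP; rewrite setD_eq0 => ABad.
  have : qform e A x <= \sum_(u in A) N.
    rewrite qformE; apply: ler_sum => u _; rewrite -[leRHS]mul1r.
    by apply: ler_pM; [exact: x0 | exact: d_ge0 | exact: x1 | exact: d_le].
  rewrite sumr_const -[N *+ _]mulr_natl => le1.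
  have le2 : #|A|%:R * N <= #|Bad|%:R * N by rewrite ler_wpM2r // ler_nat subset_leq_card.
  have le3 : #|Bad|%:R * N <= delta / 4 * N * N by rewrite ler_wpM2r.
  have : 0 <= (1 - r.+2%:R^-1) * S ^+ 2 by rewrite mulr_ge0 // sqr_ge0.
  have : 0 <= delta * N * N by rewrite !mulr_ge0 // ltW.
  rewrite -/S => ge1 ge2; apply: le_trans (le_trans le1 (le_trans le2 le3)) _.
  by move: ge2; set z := _ * S ^+ 2 => ge2; lra.
case: (arg_maxP d v0G) => v /setDP[vA vBad] vmax.
pose B := A :&: nbhd e v.
have leqB : qform e B x <= (1 - r.+1%:R^-1) * (d v) ^+ 2 + delta / 2 * N ^+ 2.
  apply: IHD => //; rewrite leqNgt; apply: contra vBad => ltv.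
  by rewrite inE vA.
have sumAB : \sum_(u in A :\: B) x u = S - d v.
  have AB : A :&: B = B by rewrite /B setIA setIid.
  have -> : S = d v + \sum_(u in A :\: B) x u by rewrite /S (big_setID B) /= AB.
  by rewrite addrAC subrr add0r.
have leAB : \sum_(u in A :\: B) x u * d u <= (S - d v) * d v + delta / 4 * N * N.
  rewrite -sumAB mulr_suml.
  apply: (@le_trans _ _ (\sum_(u in A :\: B) (x u * d v + (u \in Bad)%:R * N))).
    apply: ler_sum => u /setDP[uA _]; case uBad: (u \in Bad).
      rewrite mul1r -[leLHS]add0r lerD ?mulr_ge0 //.
      by rewrite -[leRHS]mul1r ler_pM.
    by rewrite mul0r addr0 ler_wpM2l //; apply: vmax; apply/setDP; rewrite uBad.
  rewrite big_split /= lerD2l -mulr_suml ler_wpM2r //.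
  apply: le_trans leBad; rewrite -natr_sum ler_nat -sum1_card.
  rewrite [leqLHS]big_mkcond [leqRHS]big_mkcond /=; apply: leq_sum => u _.
  by case: (u \in A :\: B); case: (u \in Bad).
have leq : qform e A x <= qform e B x + (\sum_(u in A :\: B) x u * d u) *+ 2.
  exact: qform_split (subsetIl A (nbhd e v)).
have {leq} : qform e A x <= 2 * S * d v - (1 + r.+1%:R^-1) * (d v) ^+ 2 + delta * N ^+ 2.
  apply: le_trans leq _; rewrite mulr2n.
  by move: leqB leAB; set c := r.+1%:R^-1; set q := \sum_(u in _ :\: _) _; lra.
move=> leq; apply: le_trans leq _; rewrite lerD2r -/S.
have r1 : 0 < r.+1%:R :> rat by rewrite ltr0n.
have -> : 1 - r.+2%:R^-1 = (1 + r.+1%:R^-1)^-1 :> rat.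
  rewrite -[r.+2]addn1 natrD; field; lra.
(* It remains to bound 2 S d - c d^2, with d the weighted degree of v, by S^2 / c; completing the
   square does it, as 1 / c is the coefficient wanted. *)
set c := 1 + _; have c_gt0 : 0 < c by rewrite /c ltr_wpDr // ltW // invr_gt0.
have : 0 <= c^-1 * (S - c * d v) ^+ 2 by rewrite mulr_ge0 ?sqr_ge0 // invr_ge0 ltW.
have -> : c^-1 * (S - c * d v) ^+ 2 = c^-1 * S ^+ 2 - 2 * S * d v + c * d v ^+ 2.
  by field; lra.
lra.
Qed.

(** * Densities of walks *)

Lemma bernoulli (x : rat) n : 0 <= x -> 1 + n%:R * x <= (1 + x) ^+ n.
Proof.
move=> x0; elim: n => [|n IH]; first by rewrite mul0r addr0.
rewrite exprS; apply: (@le_trans _ _ ((1 + x) * (1 + n%:R * x))).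
  have sq : 0 <= n%:R * x * x by rewrite !mulr_ge0.
  by rewrite -addn1 natrD; lra.
by rewrite ler_wpM2l // addr_ge0.
Qed.

(** Bernoulli for 1 + eta, combined with (1 - eta) * (1 + eta) <= 1. The exponent is a power of two
    because walk lengths will be doubled s times. *)
Lemma expr_small (eta eps : rat) : 0 < eta <= 1 -> 0 < eps ->
  exists s, (1 - eta) ^+ (2 ^ s) <= eps.
Proof.
move=> /andP[eta0 eta1] eps0; have [s les] := rat_nat_bound (eta * eps)^-1.
exists s; set N := (2 ^ s)%N.
have sN : s%:R <= N%:R :> rat by rewrite ler_nat ltnW // ltn_expl.
have N1 : eps^-1 <= (1 + eta) ^+ N.
  apply: le_trans (bernoulli N (ltW eta0)).
  have : (eta * eps)^-1 * eta <= N%:R * eta by rewrite ler_wpM2r ?(ltW eta0) // (le_trans les).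
  by rewrite invfM mulrAC mulVf ?gt_eqF // mul1r; lra.
have pos : 0 < (1 + eta) ^+ N by rewrite exprn_gt0 // addr_gt0.
have le1 : (1 - eta) ^+ N * (1 + eta) ^+ N <= 1.
  by rewrite -exprMn exprn_ile1 //; nra.
apply: (@le_trans _ _ ((1 + eta) ^+ N)^-1); first by rewrite -[leRHS]div1r ler_pdivlMr.
by rewrite invf_ple.
Qed.

(** The third condition is Cauchy-Schwarz. The fourth is the approximate inequality of Motzkin and
    Straus for the weights [walk l]; it reaches odd lengths only. *)
Definition walk_like (alpha delta : rat) (W : nat -> rat) : Prop :=
  [/\ forall l, 0 <= W l <= 1, forall l, W l.+1 <= W l,
      forall l, W l ^+ 2 <= W (2 * l)%N &
      forall l, W (2 * l).+1 <= alpha * W l ^+ 2 + delta].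

(* The tensor power trick: y = W (2 m) satisfies y ^ 2^s <= W (2^s 2m) <= W (2^s 2m - 1),
   and the last term is at most alpha^(2^s - 1) * W (2m - 1) ^ 2^s up to an error. *)
Lemma walk_like_even (alpha eta : rat) : 0 < alpha <= 1 -> 0 < eta <= 1 ->
  exists2 delta, 0 < delta & forall W, walk_like alpha delta W ->
    forall m, W (2 * m).+2 <= alpha * W (2 * m).+1 + eta.
Proof.
move=> /andP[alpha0 alpha1] /andP[eta0 eta1].
have [||s les] := @expr_small eta (alpha / 2); [by rewrite eta0 | lra |].
set N := (2 ^ s)%N in les.
have four_gt0 : 0 < 4 ^+ s :> rat by rewrite exprn_gt0.
have etaN : 0 < eta ^+ N by rewrite exprn_gt0.
have etaN1 : eta ^+ N <= 1 by rewrite exprn_ile1 // ltW.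
(* Each doubling below multiplies the error by at most 4: (p + tau)^2 + delta <= p^2 + 4 tau for p,
   tau <= 1 and delta <= tau. After s doublings alpha / 4 * eta ^+ N is left. *)
set delta := alpha / 4 * eta ^+ N / 4 ^+ s.
have delta0 : 0 < delta by rewrite divr_gt0 // mulr_gt0 // divr_gt0.
have deltaE : 4 ^+ s * delta = alpha / 4 * eta ^+ N by rewrite /delta mulrC divfK ?gt_eqF.
exists delta => // W [W01 Wdec Wsq Wodd] m.
have W0 l : 0 <= W l by have /andP[] := W01 l.
have W1 l : W l <= 1 by have /andP[] := W01 l.
set y := W (2 * m).+2; have y_ge0 : 0 <= y by apply: W0.
pose M i := (2 ^ i * (2 * m).+1.+1)%N.
have M_gt0 i : (0 < M i)%N by rewrite muln_gt0 expn_gt0.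
have yM i : y ^+ (2 ^ i) <= W (M i).
  elim: i => [|i IH]; first by rewrite expr1 /M mul1n.
  rewrite expnSr exprM; apply: (@le_trans _ _ (W (M i) ^+ 2)).
    by rewrite lerXn2r // nnegrE // exprn_ge0.
  by rewrite /M expnS -mulnA.
set z := alpha * W (2 * m).+1.
have z0 : 0 <= z by rewrite mulr_ge0 // ltW.
have z1 : z <= 1 by rewrite mulr_ile1 // ltW.
have zM i : (i <= s)%N -> alpha * W (M i).-1 <= z ^+ (2 ^ i) + 4 ^+ i * delta.
  elim: i => [|i IH] lt_is.
    by rewrite !expr1 mul1r /M mul1n lerDl ltW.
  have {}IH := IH (ltnW lt_is).
  have MS : (M i.+1).-1 = (2 * (M i).-1).+1.
    by rewrite /M expnS -mulnA -/(M i); have := M_gt0 i; lia.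
  have tau1 : 4 ^+ i * delta <= 1.
    apply: (@le_trans _ _ (4 ^+ s * delta)).
      by rewrite ler_wpM2r ?(ltW delta0) // ler_eXn2l ?(ltnW lt_is) //.
    by rewrite deltaE; nra.
  have tau0 : delta <= 4 ^+ i * delta by rewrite ler_peMl ?(ltW delta0) // exprn_ege1.
  rewrite MS expnSr exprM (exprS 4).
  have := Wodd (M i).-1.
  set w := W (M i).-1 in IH *; set p := z ^+ _ in IH *; set tau := 4 ^+ i * delta in IH tau1 tau0 *.
  have p0 : 0 <= p by rewrite exprn_ge0.
  have p1 : p <= 1 by rewrite exprn_ile1.
  have w0 : 0 <= alpha * w by rewrite mulr_ge0 ?(ltW alpha0) ?W0.
  move=> le1; have le2 : alpha * W (2 * (M i).-1).+1 <= (alpha * w) ^+ 2 + delta.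
    apply: (@le_trans _ _ (alpha * (alpha * w ^+ 2 + delta))).
      by rewrite ler_wpM2l // ltW.
    by rewrite mulrDr mulrA -expr2 -exprMn lerD2l ler_piMl // ltW.
  have le3 : (alpha * w) ^+ 2 <= (p + tau) ^+ 2.
    by rewrite lerXn2r // nnegrE //; lra.
  have le4 : p * tau <= tau by rewrite ler_piMl //; lra.
  have le5 : tau * tau <= tau by rewrite ler_piMl //; lra.
  rewrite -mulrA -/tau; apply: (le_trans le2); rewrite !expr2 in le3 *; lra.
(* If y > z + eta, then z <= y * (1 - eta) since y <= 1, so z ^+ N is at most alpha / 2 * y ^+ N by
   the choice of s; the error is at most alpha / 4 * y ^+ N since y >= eta. The sum falls short of
   alpha * y ^+ N. *)
rewrite leNgt; apply/negP => lt_y.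
have y_eta : eta <= y by lra.
have y1 : y <= 1 by apply: W1.
have y0 : 0 < y by lra.
have zy : z <= y * (1 - eta) by nra.
have := zM s (leqnn s); rewrite -/N deltaE => le1.
have le2 : alpha * y ^+ N <= alpha * W (M s).-1.
  rewrite ler_wpM2l ?(ltW alpha0) //; apply: le_trans (yM s) _.
  by rewrite -{1}(prednK (M_gt0 s)).
have le3 : z ^+ N <= y ^+ N * (1 - eta) ^+ N.
  by rewrite -exprMn lerXn2r // nnegrE // mulr_ge0 //; lra.
have yN : eta ^+ N <= y ^+ N by rewrite lerXn2r // nnegrE ltW.
have le4 : y ^+ N * (1 - eta) ^+ N <= y ^+ N * (alpha / 2).
  by rewrite ler_wpM2l // exprn_ge0 // ltW.
have : 0 < alpha * eta ^+ N by rewrite mulr_gt0.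
have : alpha * eta ^+ N <= alpha * y ^+ N by rewrite ler_wpM2l // ltW.
lra.
Qed.

(** Strong induction on the length. An even length is reduced to the preceding one. For 2 m + 1
    there are two factors W m: one is replaced by alpha ^+ m and the other, in the second bound, by
    alpha ^+ m.-1 * W 1, so that W 1 appears exactly once. *)
Lemma walk_like_bound (alpha eta : rat) W : 0 <= alpha <= 1 -> 0 <= eta ->
  (forall l, 0 <= W l <= 1) ->
  (forall m, W (2 * m).+1 <= alpha * W m ^+ 2 + eta) ->
  (forall m, W (2 * m).+2 <= alpha * W (2 * m).+1 + eta) ->
  forall l, W l <= alpha ^+ l + l%:R * eta /\ W l.+1 <= alpha ^+ l * W 1%N + l.+1%:R * eta.
Proof.
move=> /andP[a0 a1] eta0 W01 Wodd Weven.
have W0 l : 0 <= W l by have /andP[] := W01 l.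
have W1 l : W l <= 1 by have /andP[] := W01 l.
have aX l : 0 <= alpha ^+ l by rewrite exprn_ge0.
have aX1 l : alpha ^+ l <= 1 by rewrite exprn_ile1.
have ne l : 0 <= l%:R * eta by rewrite mulr_ge0.
suff Wl l : W l <= alpha ^+ l + l%:R * eta /\
    ((0 < l)%N -> W l <= alpha ^+ l.-1 * W 1%N + l%:R * eta).
  by move=> l; split; [have [] := Wl l | have [_ /(_ isT)] := Wl l.+1].
elim/ltn_ind: l => -[|l] IH; first by rewrite mul0r addr0.
have sR : l.+1%:R = l%:R + 1 :> rat by rewrite -addn1 natrD.
have [lodd|leven] := boolP (odd l).
  have lE : l = (2 * l./2).+1 by have := odd_double_half l; rewrite lodd -mul2n; lia.
  have [IH1 IH2] := IH l (ltnSn l).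
  have le1 : W l.+1 <= alpha * W l + eta by rewrite lE.
  rewrite exprS sR mulrDl mul1r; split.
    have : alpha * W l <= alpha * (alpha ^+ l + l%:R * eta) by rewrite ler_wpM2l.
    have : alpha * (l%:R * eta) <= l%:R * eta by rewrite ler_piMl.
    lra.
  move=> _; rewrite /=; have l0 : (0 < l)%N by rewrite lE.
  have le2 := IH2 l0.
  have Xl : alpha ^+ l = alpha * alpha ^+ l.-1 by rewrite -exprS prednK.
  rewrite Xl.
  have : alpha * W l <= alpha * (alpha ^+ l.-1 * W 1%N + l%:R * eta) by rewrite ler_wpM2l.
  have : alpha * (l%:R * eta) <= l%:R * eta by rewrite ler_piMl.
  lra.
have lE : l = (2 * l./2)%N by have := odd_double_half l; rewrite (negbTE leven) -mul2n; lia.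
set m := l./2 in lE.
have [l0|l_gt0] := posnP l.
  have := Wodd 0%N; rewrite muln0 l0 /= !expr1 !mul1r.
  have : W 0%N ^+ 2 <= 1 by rewrite exprn_ile1.
  move=> le1 le2; split=> [|_]; last by lra.
  have : alpha * W 0%N ^+ 2 <= alpha by rewrite ler_piMr.
  lra.
have m_gt0 : (0 < m)%N by lia.
have [|IH1 IH2] := IH m; first by lia.
have {}IH2 := IH2 m_gt0.
have lR : l%:R = m%:R + m%:R :> rat by rewrite -natrD; congr _%:R; lia.
have := Wodd m; rewrite -lE expr2 => le1.
have aW : alpha * W m <= 1 by rewrite mulr_ile1.
have aW0 : 0 <= alpha * W m by rewrite mulr_ge0.
have Xm : alpha ^+ l = alpha ^+ m * alpha ^+ m by rewrite -exprD; congr (_ ^+ _); lia.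
have le2 : alpha * (W m * W m) <= alpha * W m * (alpha ^+ m) + m%:R * eta.
  rewrite mulrA; have : alpha * W m * W m <= alpha * W m * (alpha ^+ m + m%:R * eta).
    by rewrite ler_wpM2l.
  have : alpha * W m * (m%:R * eta) <= m%:R * eta by rewrite ler_piMl.
  lra.
have aa0 : 0 <= alpha * alpha ^+ m by rewrite mulr_ge0.
have aa1 : alpha * alpha ^+ m <= 1 by rewrite mulr_ile1.
have le3 : alpha * alpha ^+ m * (m%:R * eta) <= m%:R * eta by rewrite ler_piMl.
rewrite exprS sR mulrDl mul1r /= Xm lR; split.
  have : alpha * alpha ^+ m * W m <= alpha * alpha ^+ m * (alpha ^+ m + m%:R * eta).
    by rewrite ler_wpM2l.
  lra.
move=> _.
have : alpha * alpha ^+ m * W m <= alpha * alpha ^+ m * (alpha ^+ m.-1 * W 1%N + m%:R * eta).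
  by rewrite ler_wpM2l.
have -> : alpha ^+ m * alpha ^+ m = alpha * alpha ^+ m * alpha ^+ m.-1.
  by rewrite -{1}(prednK m_gt0) exprS; ring.
lra.
Qed.

Section Walks.
Variables (V : finType) (e : rel V).
Hypothesis esym : symmetric e.
Implicit Types x y : V -> rat.

Let N : rat := #|V|%:R.

Definition average x : rat := (\sum_v x v) / #|V|%:R.

(** The adjacency operator divided by the number of vertices; this keeps weights in [0, 1], as the
    inequality of Motzkin and Straus requires here. *)
Definition average_nbhd x v : rat := (\sum_(u | e v u) x u) / #|V|%:R.

Definition walk l : V -> rat := iter l average_nbhd (fun=> 1).

Definition walk_density l : rat := average (walk l).

Let N_ge0 : 0 <= N. Proof. exact: ler0n. Qed.

Lemma eq_average x y : x =1 y -> average x = average y.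
Proof. by move=> xy; rewrite /average; congr (_ / _); apply: eq_bigr. Qed.

Lemma average_nbhd_adjoint x y :
  average (fun v => x v * average_nbhd y v) = average (fun v => average_nbhd x v * y v).
Proof.
rewrite /average; congr (_ / _).
transitivity (\sum_v \sum_u (if e v u then x v * y u / N else 0)).
  by apply: eq_bigr => v _; rewrite -big_mkcond /= /average_nbhd mulrA mulr_sumr mulr_suml.
rewrite exchange_big; apply: eq_bigr => v _ /=; rewrite -big_mkcond /= /average_nbhd.
rewrite mulr_suml mulr_suml; apply: eq_big => [u|u _]; first by rewrite esym.
by rewrite mulrAC.
Qed.

Lemma average01 x : (forall v, 0 <= x v <= 1) -> 0 <= average x <= 1.
Proof.
move=> x01; apply/andP; split.
  by rewrite divr_ge0 //; apply: sumr_ge0 => v _; have /andP[] := x01 v.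
have [N0|N_gt0] := eqVneq N 0; first by rewrite /average -/N N0 invr0 mulr0.
rewrite ler_pdivrMr ?mul1r ?lt0r ?N_gt0 //.
rewrite -sum1_card natr_sum; apply: ler_sum => v _; by have /andP[] := x01 v.
Qed.

Lemma average_nbhd01 x v : (forall v, 0 <= x v <= 1) -> 0 <= average_nbhd x v <= 1.
Proof.
move=> x01; rewrite /average_nbhd big_mkcond.
apply: (@average01 (fun u => if e v u then x u else 0)) => u.
by case: ifP => _; rewrite ?lexx ?ler01.
Qed.

Lemma average_le x y : (forall v, x v <= y v) -> average x <= average y.
Proof. by move=> xy; rewrite ler_wpM2r ?invr_ge0 //; apply: ler_sum. Qed.

Lemma walk01 l v : 0 <= walk l v <= 1.
Proof.
elim: l v => [|l IH] v; first by rewrite lexx ler01.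
by rewrite /walk iterS; apply: average_nbhd01.
Qed.

(** A walk is cut at its a-th vertex; by symmetry of e the first piece can be read backwards. *)
Lemma walk_densityD a b : walk_density (a + b) = average (fun v => walk a v * walk b v).
Proof.
elim: a b => [|a IH] b; first by apply: eq_average => v; rewrite mul1r.
by rewrite addSnnS IH; apply: average_nbhd_adjoint.
Qed.

Lemma average_sqr x : average x ^+ 2 <= average (fun v => x v ^+ 2).
Proof.
have [N0|N0] := eqVneq N 0; first by rewrite /average -/N N0 invr0 !mulr0 expr0n.
have N_gt0 : 0 < N by rewrite lt0r N0.
set m := average x; have sumx : \sum_v x v = m * N by rewrite /m /average divfK.
have : 0 <= \sum_v (x v - m) ^+ 2 by apply: sumr_ge0 => v _; rewrite sqr_ge0.
have -> : \sum_v (x v - m) ^+ 2 = \sum_v x v ^+ 2 - 2 * m * (\sum_v x v) + N * m ^+ 2.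
  rewrite mulr_sumr -sumrB /N -sum1_card natr_sum mulr_suml -big_split /=.
  by apply: eq_bigr => v _; ring.
by rewrite sumx ler_pdivlMr //; lra.
Qed.

Lemma average_qform x : average (fun v => x v * average_nbhd x v) = qform e setT x / N ^+ 2.
Proof.
rewrite /average expr2 invfM mulrA; congr (_ / _); rewrite qformE mulr_suml.
apply: eq_big => [v|v _]; first by rewrite inE.
rewrite /average_nbhd mulrA; congr (_ * _ / _); apply: eq_bigl => u.
by rewrite !inE.
Qed.

Definition motzkin_straus_for (alpha delta : rat) : Prop :=
  forall x, (forall v, 0 <= x v <= 1) ->
    qform e setT x <= alpha * (\sum_v x v) ^+ 2 + delta * N ^+ 2.

Lemma walk_like_density alpha delta : (0 < #|V|)%N ->
  motzkin_straus_for alpha delta -> walk_like alpha delta walk_density.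
Proof.
move=> V_gt0 ms; have N_gt0 : 0 < N by rewrite ltr0n.
split=> l; first exact/average01/walk01.
- rewrite -addn1 walk_densityD; apply: average_le => v.
  by have /andP[w0 w1] := walk01 l v; have /andP[_ ?] := walk01 1 v; rewrite ler_piMr.
- rewrite mul2n -addnn walk_densityD; apply: le_trans (average_sqr _) _.
  by apply: average_le => v; rewrite expr2.
rewrite mul2n -addnn -addnS walk_densityD.
rewrite -[leLHS]/(average (fun v => walk l v * average_nbhd (walk l) v)) average_qform.
rewrite ler_pdivrMr ?exprn_gt0 //; apply: le_trans (ms _ (walk01 l)) _.
by rewrite /walk_density /average mulrDl exprMn exprVn -mulrA divfK // expf_neq0 // gt_eqF.
Qed.

(** The density version of [seq_count] without the demand that vertices be distinct, hence an upper
    bound for it. *)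
Fixpoint flag_walk (b : seq bool) (v : V) : rat :=
  if b is d :: b' then (\sum_(y | d ==> e v y) flag_walk b' y) / N else 1.

Lemma flag_walk_ge0 b v : 0 <= flag_walk b v.
Proof. by elim: b v => //= d b IH v; rewrite divr_ge0 //; apply: sumr_ge0. Qed.

Lemma seq_count_le b v U : (0 < #|V|)%N ->
  (seq_count e b v U)%:R <= N ^+ size b * flag_walk b v.
Proof.
move=> V_gt0; have N_neq0 : N != 0 by rewrite pnatr_eq0 -lt0n.
elim: b v U => [|d b IH] v U /=; first by rewrite mulr1.
rewrite exprSr -mulrA [N * _]mulrC divfK // natr_sum mulr_sumr.
rewrite [leLHS]big_mkcond [leRHS]big_mkcond; apply: ler_sum => y _ /=.
case: ifP => [/andP[_ ->]//|_]; case: ifP => // _.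
by rewrite mulr_ge0 ?exprn_ge0 // flag_walk_ge0.
Qed.

(** An unset flag separates independent walks, so the density is a product over the runs of set
    flags; l is the length of the current run. *)
Fixpoint run_density l (b : seq bool) : rat :=
  match b with
  | [::] => walk_density l
  | true :: b' => run_density l.+1 b'
  | false :: b' => walk_density l * run_density 0 b'
  end.

Lemma run_densityE l b : average (fun v => walk l v * flag_walk b v) = run_density l b.
Proof.
elim: b l => [|[] b IH] l /=; first by apply: eq_average => v; rewrite mulr1.
  by rewrite -IH -average_nbhd_adjoint.
rewrite -IH /walk_density /average -mulr_suml mulrAC; congr (_ * (_ / _)).
by apply: eq_bigr => u _; rewrite mul1r.
Qed.

(** A single run with an edge supplies the factor [walk_density 1]; all others are bounded by powers
    of alpha. Since all factors lie in [0, 1], the errors just add up. *)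
Lemma run_density_bound (alpha eta : rat) b l : 0 <= alpha <= 1 -> 0 <= eta ->
  (forall l, walk_density l <= alpha ^+ l + l%:R * eta /\
     walk_density l.+1 <= alpha ^+ l * walk_density 1 + l.+1%:R * eta) ->
  [/\ 0 <= run_density l b <= 1,
      run_density l b <= alpha ^+ (l + count id b) + (l + size b)%:R * eta &
      (0 < l + count id b)%N -> run_density l b <=
        alpha ^+ (l + count id b).-1 * walk_density 1 + (l + size b)%:R * eta].
Proof.
move=> /andP[a0 a1] eta0 Wb.
have aX i : 0 <= alpha ^+ i by rewrite exprn_ge0.
have aX1 i : alpha ^+ i <= 1 by rewrite exprn_ile1.
have ne i : 0 <= i%:R * eta by rewrite mulr_ge0.
have W01 i : 0 <= walk_density i <= 1 by apply/average01/walk01.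
have prod (u A w B s t : rat) : 0 <= A <= 1 -> 0 <= w <= 1 -> 0 <= s ->
    u <= A + s -> w <= B + t -> 0 <= t -> u * w <= A * B + (s + t).
  move=> /andP[A0 A1] /andP[w0 w1] s0 uA wB t0.
  have : u * w <= (A + s) * w by rewrite ler_wpM2r.
  have : A * w <= A * (B + t) by rewrite ler_wpM2l.
  have : s * w <= s by rewrite ler_piMr.
  have : A * t <= t by rewrite ler_piMl.
  lra.
elim: b l => [|[] b IH] l /=.
- rewrite !addn0; have [W1 _] := Wb l; split=> // l_gt0.
  by have [_] := Wb l.-1; rewrite (prednK l_gt0).
- by have := IH l.+1; rewrite !addSnnS ?add1n.
have [R01 R1 R2] := IH 0%N; rewrite !add0n in R1 R2.
have [Wl _] := Wb l.
have sz : (l + (size b).+1)%:R * eta = l%:R * eta + ((size b)%:R * eta + eta).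
  by rewrite natrD -[(size b).+1]addn1 natrD; ring.
rewrite add0n sz; split.
- by have /andP[? ?] := W01 l; have /andP[? ?] := R01; rewrite mulr_ge0 // mulr_ile1.
- have := prod _ _ _ _ _ _ _ R01 (ne l) Wl R1 (ne _); rewrite aX aX1 exprD => /(_ isT); lra.
case: l Wl sz => [|l] Wl sz lb.
  have le1 := R2 lb; rewrite add0n mul0r add0r; apply: le_trans (_ : run_density 0 b <= _).
    by have /andP[? ?] := R01; have /andP[_ ?] := W01 0%N; rewrite ler_piMl.
  by lra.
have [_ Wl1] := Wb l.
have A01 : 0 <= alpha ^+ l * walk_density 1 <= 1.
  by have /andP[? ?] := W01 1%N; rewrite mulr_ge0 // mulr_ile1.
have := prod _ _ _ _ _ _ A01 R01 (ne l.+1) Wl1 R1 (ne _).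
rewrite addSn /= exprD; lra.
Qed.

End Walks.

(* Every density W_l of walks satisfies W_l <= alpha^(l-1) W_1 up to an error, hence so
   does the product over the components of a linear forest. *)
Lemma many_walks_many_edges (alpha gamma : rat) (b : seq bool) : 0 < alpha <= 1 -> 0 < gamma ->
  (0 < count id b)%N ->
  exists2 delta, 0 < delta & forall (V : finType) (e : rel V) (v : V),
    symmetric e -> motzkin_straus_for e alpha delta ->
    (alpha ^+ count id b - delta) * #|V|%:R ^+ (size b).+1 <=
      (seq_count e (false :: b) v set0)%:R ->
    (alpha - gamma) * #|V|%:R ^+ 2 <= \sum_u #|nbhd e u|%:R.
Proof.
move=> /andP[a0 a1] gamma0 b_gt0; set m := count id b in b_gt0 *.
set h := (size b).+1.
have am0 : 0 < alpha ^+ m.-1 by rewrite exprn_gt0.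
have am1 : alpha ^+ m.-1 <= 1 by rewrite exprn_ile1 // ltW.
have h1 : 1 <= h%:R :> rat by rewrite ler1n.
(* The error is at most eta from the assumed count and size b * eta from the runs, h * eta in all;
   it has to stay below gamma * alpha ^+ m.-1, because alpha ^+ m.-1 is divided out at the end. *)
pose eta := Num.min 1 (gamma * alpha ^+ m.-1 / (2 * h%:R)).
have q_gt0 : 0 < gamma * alpha ^+ m.-1 / (2 * h%:R).
  by rewrite divr_gt0 ?mulr_gt0 //; lra.
have eta0 : 0 < eta by rewrite lt_min ltr01.
have eta1 : eta <= 1 by rewrite ge_min lexx.
have etah : h%:R * eta <= gamma * alpha ^+ m.-1 / 2.
  apply: (@le_trans _ _ (h%:R * (gamma * alpha ^+ m.-1 / (2 * h%:R)))).
    by rewrite ler_wpM2l // ?ge_min ?lexx ?orbT //; lra.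
  by rewrite le_eqVlt; apply/orP; left; apply/eqP; field; lra.
have [||d0 d0_gt0 even] := @walk_like_even alpha eta; [by rewrite a0 | by rewrite eta0 |].
exists (Num.min d0 eta) => [|V e v esym ms le_count]; first by rewrite lt_min d0_gt0.
have V_gt0 : (0 < #|V|)%N by apply/card_gt0P; exists v.
set N : rat := #|V|%:R; have N_gt0 : 0 < N by rewrite ltr0n.
have wl := walk_like_density esym V_gt0 ms.
have le_d0 : Num.min d0 eta <= d0 by rewrite ge_min lexx.
have le_eta : Num.min d0 eta <= eta by rewrite ge_min lexx orbT.
have wl0 : walk_like alpha d0 (walk_density e).
  case: wl => W01 Wdec Wsq Wodd; split=> // l; apply: le_trans (Wodd l) _.
  by rewrite lerD2l.
have Wodd l : walk_density e (2 * l).+1 <= alpha * walk_density e l ^+ 2 + eta.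
  by case: wl => _ _ _ odd; apply: le_trans (odd l) _; rewrite lerD2l.
have W01 l : 0 <= walk_density e l <= 1 by case: wl.
have a01 : 0 <= alpha <= 1 by rewrite (ltW a0).
have Wb := walk_like_bound a01 (ltW eta0) W01 Wodd (even _ wl0).
have [_ _ /(_ b_gt0)] := run_density_bound b 0 a01 (ltW eta0) Wb.
rewrite !add0n -/m => leR.
have : (alpha ^+ m - Num.min d0 eta) * N ^+ h <= run_density e 0 b * N ^+ h.
  apply: le_trans le_count _; apply: le_trans (seq_count_le e _ _ _ V_gt0) _.
  rewrite /= -/h -run_densityE // mulrC le_eqVlt; apply/orP; left; apply/eqP; congr (_ / _ * _).
  by apply: eq_bigr => u _; rewrite mul1r.
rewrite ler_pM2r ?exprn_gt0 // => le1.
have le2 : (size b)%:R * eta + eta = h%:R * eta.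
  by rewrite /h -[(size b).+1]addn1 natrD mulrDl mul1r.
have Xm : alpha ^+ m = alpha ^+ m.-1 * alpha by rewrite -exprSr prednK.
have le3 : alpha ^+ m.-1 * (alpha - gamma) <= alpha ^+ m.-1 * walk_density e 1.
  have : 0 < alpha ^+ m.-1 * gamma by rewrite mulr_gt0.
  by rewrite Xm in le1; lra.
rewrite ler_pM2l // in le3.
have -> : \sum_u #|nbhd e u|%:R = walk_density e 1 * N ^+ 2.
  rewrite /walk_density /average expr2 mulrA -/N divfK ?gt_eqF // mulr_suml.
  apply: eq_bigr => u _; rewrite /walk /= /average_nbhd divfK ?gt_eqF //.
  by rewrite -sum1_card natr_sum; apply: eq_bigl => w; rewrite inE.
by rewrite ler_wpM2r // sqr_ge0.
Qed.

Lemma seq_count_ge (V : finType) (e : rel V) (alpha kappa : rat) h b v (U : {set V}) :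
  0 <= alpha <= 1 -> 0 <= kappa ->
  (forall U : {set V}, (#|U| <= h)%N -> (1 - kappa) * #|V|%:R <= #|~: U|%:R) ->
  (forall (U : {set V}) u, (#|U| <= h)%N -> (alpha - kappa) * #|V|%:R <= #|nbhd e u :\: U|%:R) ->
  (#|U| + size b <= h)%N ->
  (alpha ^+ count id b - (size b)%:R * kappa) * #|V|%:R ^+ size b <= (seq_count e b v U)%:R.
Proof.
move=> /andP[a0 a1] k0 freeU freeN; set N : rat := #|V|%:R.
have N_ge0 : 0 <= N by rewrite ler0n.
elim: b v U => [|d b IH] v U; first by rewrite mul0r subr0 mul1r.
rewrite /= => leh.
set c := count id b; set s := size b in leh *.
have ac0 : 0 <= alpha ^+ c by rewrite exprn_ge0.
have ac1 : alpha ^+ c <= 1 by rewrite exprn_ile1.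
have sk : 0 <= s%:R * kappa by rewrite mulr_ge0.
set a := if d then alpha else 1.
have a_ge0 : 0 <= a by rewrite /a; case: ifP.
have a_le1 : a <= 1 by rewrite /a; case: ifP.
have -> : alpha ^+ (d + c) = a * alpha ^+ c.
  by rewrite exprD /a; case: (d); rewrite ?expr1 ?expr0.
have sS : s.+1%:R = s%:R + 1 :> rat by rewrite -addn1 natrD.
have [neg|pos] := ltP (alpha ^+ c - s%:R * kappa) 0.
  apply: (@le_trans _ _ 0); last by rewrite ler0n.
  rewrite mulr_le0_ge0 ?exprn_ge0 // sS.
  have : a * alpha ^+ c <= alpha ^+ c by rewrite ler_piMl.
  lra.
pose P := [set y | (y \notin U) && (d ==> e v y)].
have leP : (a - kappa) * N <= #|P|%:R.
  have leU : (#|U| <= h)%N by apply: leq_trans leh; rewrite leq_addr.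
  rewrite /a /P; case: (d) => /=.
    apply: le_trans (freeN U v leU) _; rewrite ler_nat; apply/eq_leq/eq_card => y.
    by rewrite !inE.
  apply: le_trans (freeU U leU) _; rewrite ler_nat; apply/eq_leq/eq_card => y.
  by rewrite !inE andbT.
have lesum : #|P|%:R * ((alpha ^+ c - s%:R * kappa) * N ^+ s) <=
   (\sum_(y | (y \notin U) && (d ==> e v y)) seq_count e b y (y |: U))%:R.
  rewrite natr_sum mulr_natl -sumr_const big_mkcond [leRHS]big_mkcond /=.
  apply: ler_sum => y _; rewrite inE; case: ifP => // /andP[yU _].
  by apply: IH; rewrite cardsU1 yU add1n addSnnS.
apply: le_trans lesum.
apply: (@le_trans _ _ ((a - kappa) * N * ((alpha ^+ c - s%:R * kappa) * N ^+ s))); last first.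
  by rewrite ler_wpM2r // mulr_ge0 // exprn_ge0.
rewrite [N ^+ s.+1]exprS.
have -> : (a - kappa) * N * ((alpha ^+ c - s%:R * kappa) * N ^+ s) =
   (a - kappa) * (alpha ^+ c - s%:R * kappa) * (N * N ^+ s) by ring.
rewrite ler_wpM2r ?mulr_ge0 ?exprn_ge0 // sS.
have : a * (s%:R * kappa) <= s%:R * kappa by rewrite ler_piMl.
have : alpha ^+ c * kappa <= kappa by rewrite ler_piMl.
have : 0 <= kappa * (s%:R * kappa) by rewrite mulr_ge0.
lra.
Qed.

Local Close Scope ring_scope.

(** * Colour-critical graphs *)

Lemma colorableP (V : finType) (E : {set {set V}}) k :
  reflect (exists c : V -> 'I_k, forall x y, [set x; y] \in E -> c x != c y) (colorable E k).
Proof.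
apply: (iffP existsP) => [[c /forallP cE]|[c cE]].
  by exists c => x y xy; have /forallP/(_ y)/implyP := cE x; apply.
exists [ffun x => c x]; apply/forallP => x; apply/forallP => y; apply/implyP.
by rewrite !ffunE; apply: cE.
Qed.

Lemma colorable_leq (V : finType) (E : {set {set V}}) j k :
  j <= k -> colorable E j -> colorable E k.
Proof.
move=> jk /colorableP[c cE]; apply/colorableP.
exists (fun x => widen_ord jk (c x)) => x y /cE; apply: contraNneq => /(congr1 val) /= cxy.
exact/eqP/val_inj.
Qed.

Lemma colorable_card (V : finType) (E : {set {set V}}) : sgraph E -> colorable E #|V|.
Proof.
move=> sE; apply/colorableP; exists enum_rank => x y.
by apply: contraTneq => /enum_rank_inj ->; rewrite -/(gadj E y y) gadj_irr.
Qed.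

Lemma chi_colorable (V : finType) (E : {set {set V}}) : sgraph E -> colorable E (chi E).
Proof.
move=> sE; rewrite /chi; elim/big_ind: _ => //; first exact: colorable_card.
by move=> i j iE jE; rewrite /minn; case: ifP.
Qed.

Lemma chi_le (V : finType) (E : {set {set V}}) k : sgraph E -> colorable E k -> chi E <= k.
Proof.
move=> sE.
have small j : j <= #|V| -> colorable E j -> chi E <= j.
  rewrite -ltnS => jV jE; rewrite /chi.
  have := mem_index_enum (Ordinal jV); elim: (index_enum _) => //= i r IH.
  rewrite inE big_cons => /predU1P[<- /=|/IH le_r]; first by rewrite jE geq_minl.
  by case: ifP => // _; apply: leq_trans (geq_minr _ _) le_r.
move=> kE; have [kV|/ltnW Vk] := leqP k #|V|; first exact: small.
exact: leq_trans (small _ (leqnn _) (colorable_card sE)) Vk.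
Qed.

(** A k-colouring of F without its critical edge; were the ends coloured differently, it would be a
    colouring of F with fewer than chi F colours. *)
Lemma critical_coloring (V : finType) (F : {set {set V}}) k :
  sgraph F -> has_color_critical_edge F -> chi F = k.+1 ->
  exists a b (c : V -> 'I_k), [/\ [set a; b] \in F, a != b, c a = c b &
    forall x y, [set x; y] \in F -> [set x; y] != [set a; b] -> c x != c y].
Proof.
move=> sF /exists_inP[A AF ltA] chiF.
have sFA : sgraph (F :\ A).
  apply/forallP => B; apply/implyP; rewrite inE => /andP[_].
  by have /forallP/(_ B)/implyP := sF.
have [a [b [ab eA]]] := sgraph_edge sF AF.
have /colorableP[c cF] : colorable (F :\ A) k.
  by apply: colorable_leq (chi_colorable sFA); rewrite -ltnS -chiF.
have cF' x y : [set x; y] \in F -> [set x; y] != [set a; b] -> c x != c y.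
  by move=> xyF xyA; apply: cF; rewrite inE xyF andbT eA inE.
exists a, b, c; split=> //; first by rewrite -eA.
apply: contraTeq isT => cab; have : colorable F k.
  apply/colorableP; exists c => x y xyF.
  have [/setP xyab|] := eqVneq [set x; y] [set a; b]; last exact: cF'.
  have xy : x != y by apply: contraTneq xyF => ->; rewrite -/(gadj F y y) gadj_irr.
  have := xyab x; have := xyab y; rewrite !inE !eqxx ?orbT /=.
  move=> /esym/pred2P[] yE /esym/pred2P[] xE; subst => //; rewrite ?eqxx // in xy *.
  by rewrite eq_sym.
by move/(chi_le sF); rewrite chiF ltnn.
Qed.

(* The critical edge is mapped to p q, the colour classes of the rest into the S i. *)
Lemma critical_embedding (VF V : finType) (F : {set {set VF}}) k (e : rel V)
    (S : 'I_k -> {set V}) (j : 'I_k) (p q : V) :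
  sgraph F -> has_color_critical_edge F -> chi F = k.+1 ->
  symmetric e -> irreflexive e ->
  e p q -> p \notin S j -> q \notin S j ->
  (forall i w, i != j -> w \in S i -> e p w && e q w) ->
  (forall i i' u w, i != i' -> u \in S i -> w \in S i' -> e u w) ->
  (forall i, #|VF| <= #|S i|) ->
  embr F e != set0.
Proof.
move=> sF crit chiF esym eirr epq pS qS pqS eS cS.
have [a [b [c0 [abF ab c0ab c0F]]]] := critical_coloring sF crit chiF.
(* Colours are permuted so that both ends of the critical edge get j, the one class to which p and q
   need not be joined. *)
pose c x := tperm (c0 a) j (c0 x).
have ca : c a = j by rewrite /c tpermL.
have cb : c b = j by rewrite /c -c0ab tpermL.
have cF x y : [set x; y] \in F -> [set x; y] != [set a; b] -> c x != c y.
  by move=> xyF xyab; rewrite (inj_eq perm_inj) c0F.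
(* The position within a class is the rank of x among all vertices of F. This gives injectivity as
   soon as every class has |VF| elements; the default p is never reached. *)
pose g x := nth p (enum (S (c x))) (enum_rank x).
have lt_g x : enum_rank x < size (enum (S (c x))).
  by rewrite -cardE; apply: leq_trans (cS _); apply: ltn_ord.
have gS x : g x \in S (c x) by rewrite -mem_enum mem_nth.
have disj i i' u : u \in S i -> u \in S i' -> i = i'.
  move=> ui ui'; apply: contraTeq isT => ii'.
  by have := eS _ _ _ _ ii' ui ui'; rewrite eirr.
have gi x y : g x = g y -> x = y.
  move=> gxy; have cxy : c x = c y by apply: (disj _ _ (g x)); rewrite // gxy.
  apply: enum_rank_inj; apply: val_inj; apply/eqP => /=.
  rewrite -(nth_uniq p (lt_g x) _ (enum_uniq _)) ?cxy //.
  by apply/eqP; move: gxy; rewrite /g cxy.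
have pq : p != q by apply: contraTneq epq => ->; rewrite eirr.
have pg x : p != g x.
  have [cx|cx] := eqVneq (c x) j; first by apply: contraNneq pS => ->; rewrite -cx.
  by have /andP[+ _] := pqS _ _ cx (gS x); apply: contraTneq => ->; rewrite eirr.
have qg x : q != g x.
  have [cx|cx] := eqVneq (c x) j; first by apply: contraNneq qS => ->; rewrite -cx.
  by have /andP[_ +] := pqS _ _ cx (gS x); apply: contraTneq => ->; rewrite eirr.
apply/set0Pn; exists [ffun x => if x == a then p else if x == b then q else g x].
have irrF x : [set x; x] \notin F by rewrite -/(gadj F x x) gadj_irr.
apply/embrP; split=> [x y|x y xyF]; rewrite !ffunE.
  case: (eqVneq x a) => [->|xa]; case: (eqVneq y a) => [-> //|ya].
  - case: (eqVneq y b) => [->|yb] /eqP; first by rewrite (negbTE pq).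
    by rewrite (negbTE (pg y)).
  - case: (eqVneq x b) => [->|xb] /eqP; first by rewrite eq_sym (negbTE pq).
    by rewrite eq_sym (negbTE (pg x)).
  case: (eqVneq x b) => [->|xb]; case: (eqVneq y b) => [-> //|yb].
  - by move/eqP; rewrite (negbTE (qg y)).
  - by move/eqP; rewrite eq_sym (negbTE (qg x)).
  exact: gi.
have main x' y' : [set x'; y'] \in F -> x' = a \/ x' = b -> y' != a -> y' != b ->
    e p (g y') && e q (g y').
  move=> xyF' xab ya yb; apply: (pqS (c y')) => //.
  have cxj : c x' = j by case: xab => ->.
  rewrite -cxj eq_sym; apply: cF => //; apply: contraTneq isT => /setP/(_ y').
  by rewrite !inE eqxx orbT (negbTE ya) (negbTE yb).
case: (eqVneq x a) => [xa|xa]; case: (eqVneq y a) => [ya|ya].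
- by move: (irrF a); rewrite -{1}xa -{1}ya xyF.
- case: (eqVneq y b) => [//|yb].
  by have /andP[] := main x y xyF (or_introl xa) ya yb.
- case: (eqVneq x b) => [_|xb]; first by rewrite esym.
  rewrite setUC in xyF; rewrite esym.
  by have /andP[] := main y x xyF (or_introl ya) xa xb.
case: (eqVneq x b) => [xb|xb]; case: (eqVneq y b) => [yb|yb].
- by move: (irrF b); rewrite -{1}xb -{1}yb xyF.
- by have /andP[] := main x y xyF (or_intror xb) ya yb.
- rewrite setUC in xyF; rewrite esym.
  by have /andP[] := main y x xyF (or_intror yb) xa xb.
apply: (eS (c x) (c y)) => //; apply: cF => //.
apply: contraTneq isT => /setP/(_ a).
by rewrite !inE eqxx ![a == _]eq_sym (negbTE xa) (negbTE ya).
Qed.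

Lemma card_bigcup_seq_le (I V : finType) (l : seq I) (A : I -> {set V}) m :
  (forall i, i \in l -> #|A i| <= m) -> #|\bigcup_(i <- l) A i| <= size l * m.
Proof.
elim: l => [|i l IH] Am; first by rewrite big_nil cards0.
rewrite big_cons mulSn; apply: leq_trans (leq_card_setU _ _) _.
by rewrite leq_add ?Am ?mem_head // IH // => i' i'l; rewrite Am // inE i'l orbT.
Qed.

(** The classes are treated in turn, each avoiding the at most |I| * (q * z) vertices related to
    earlier choices. It is used for non-adjacency between classes, where it yields complete
    multipartite graphs, and for equality, where it yields disjoint sets. *)
Lemma greedy_selection (I V : finType) (R : rel V) (B : I -> {set V}) q z :
  symmetric R -> (forall i u, u \in B i -> #|[set w | R u w]| <= z) ->
  (forall i, #|I| * (q * z) + q <= #|B i|) ->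
  exists S : I -> {set V}, (forall i, S i \subset B i /\ #|S i| = q) /\
    (forall i i' u w, i != i' -> u \in S i -> w \in S i' -> ~~ R u w).
Proof.
move=> Rsym Rz cB.
suff [S [S1 S2]] : exists S : I -> {set V},
    (forall i, i \in enum I -> S i \subset B i /\ #|S i| = q) /\
    (forall i i' u w, i \in enum I -> i' \in enum I -> i != i' ->
       u \in S i -> w \in S i' -> ~~ R u w).
  by exists S; split=> *; [apply: S1 | apply: S2]; rewrite ?mem_enum; eauto.
have : size (enum I) <= #|I| by rewrite cardE.
have : uniq (enum I) by apply: enum_uniq.
elim: (enum I) => [|i l IH] /= => [_ _|/andP[il ul] szl].
  by exists (fun=> set0).
have [|S [S1 S2]] := IH ul; first exact: ltnW.
pose Fb := \bigcup_(i' <- l) \bigcup_(u <- enum (S i')) [set w | R u w].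
have cFb : #|Fb| <= #|I| * (q * z).
  apply: leq_trans (_ : size l * (q * z) <= _); last by rewrite leq_mul2r (ltnW szl) orbT.
  apply: card_bigcup_seq_le => i' /S1[SB cS].
  rewrite -cS [#|S i'|]cardE; apply: card_bigcup_seq_le => u; rewrite mem_enum => uS.
  by apply: (Rz i'); apply: (subsetP SB).
have [|Si SiB cSi] := @exists_subset_card _ (B i :\: Fb) q.
  rewrite cardsD; have := subset_leq_card (subsetIr (B i) Fb); have := cB i; lia.
have SiF i' u w : i' \in l -> u \in S i' -> w \in Si -> ~~ R u w.
  move=> i'l uS /(subsetP SiB)/setDP[_]; apply: contra => Ruw.
  rewrite /Fb bigcup_seq; apply/bigcupP; exists i' => //.
  by rewrite bigcup_seq; apply/bigcupP; exists u; rewrite ?mem_enum ?inE.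
exists (fun i' => if i' == i then Si else S i'); split.
  move=> i'; rewrite inE; case: eqVneq => [-> _|_ /= /S1 //]; split=> //.
  exact: subset_trans SiB (subsetDl _ _).
move=> i1 i2 u w; rewrite !inE.
case: eqVneq => [->|ne1] /=; case: eqVneq => [->|ne2] /= i1l i2l; rewrite ?eqxx //.
- by move=> _ uS wS; rewrite Rsym; apply: (SiF i2).
- by move=> _ uS wS; apply: (SiF i1).
exact: S2.
Qed.

(** The embeddings with the same image as f0 are exactly f0 composed with the self-embeddings of H,
    and these are automorphisms because H is finite. *)
Lemma card_embeddings (VH V : finType) (H : {set {set VH}}) (G : {set {set V}}) :
  #|embeddings H G| = Ncopies H G * #|embeddings H H|.
Proof.
pose img (f : {ffun VH -> V}) := (f @: [set: VH], [set f @: A | A : {set VH} in H]).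
rewrite /Ncopies -sum_nat_const -sum1_card (partition_big img (mem (copies H G))) /=; last first.
  by move=> f fE; apply/imsetP; exists f.
apply: eq_bigr => _ /imsetP[f0 f0E ->]; rewrite -/(img f0).
have homP (W : finType) (K : {set {set W}}) (f : {ffun VH -> W}) : reflect
    (injective f /\ forall A : {set VH}, A \in H -> f @: A \in K) (f \in embeddings H K).
  rewrite inE; apply: (iffP andP) => [[/injectiveP fi /forallP fK]|[fi fK]]; split=> //.
  - by move=> A AH; have /implyP := fK A; apply.
  - exact/injectiveP.
  - by apply/forallP => A; apply/implyP; apply: fK.
have [f0i f0G] := homP _ _ _ f0E.
pose comp (s : {ffun VH -> VH}) : {ffun VH -> V} := [ffun x => f0 (s x)].
have compE (s : {ffun VH -> VH}) (A : {set VH}) : comp s @: A = f0 @: (s @: A).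
  by rewrite -imset_comp; apply: eq_imset => x; rewrite ffunE.
have comp_inj : injective comp.
  by move=> s t /ffunP st; apply/ffunP => x; apply: f0i; have := st x; rewrite !ffunE.
rewrite sum1dep_card -(card_imset _ comp_inj); apply: eq_card => f.
rewrite inE; apply/andP/imsetP => [[fE /eqP[fV fH]]|[s sE ->]].
  have [fi fG] := homP _ _ _ fE.
  have im x : f x \in codom f0.
    have : f x \in f0 @: [set: VH] by rewrite -fV imset_f.
    by case/imsetP => y _ ->; apply: codom_f.
  pose s := [ffun x => iinv (im x)].
  have sE x : f0 (s x) = f x by rewrite ffunE f_iinv.
  have fE' : f = comp s by apply/ffunP => x; rewrite ffunE sE.
  exists s => //; apply/homP; split=> [x y sxy|A AH].
    by apply: fi; rewrite -!sE sxy.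
  have : f @: A \in [set f0 @: A | A : {set VH} in H] by rewrite -fH imset_f.
  by case/imsetP => B BH; rewrite fE' compE => /(imset_inj f0i) ->.
have [si sH] := homP _ _ _ sE; split.
  apply/homP; split=> [x y|A AH]; first by rewrite !ffunE => /f0i/si.
  by rewrite compE f0G // sH.
have sV : s @: [set: VH] = [set: VH].
  by apply/eqP; rewrite eqEcard subsetT card_imset // leqnn.
have sHE : [set s @: A | A : {set VH} in H] = H.
  apply/eqP; rewrite eqEcard; apply/andP; split.
    by apply/subsetP => _ /imsetP[A AH ->]; apply: sH.
  by rewrite card_imset //; apply: imset_inj.
apply/eqP; congr (_, _); first by rewrite compE sV.
rewrite -[in RHS]sHE -imset_comp; apply: eq_imset => A.
by rewrite compE.
Qed.

Lemma Ncopies_le (VH V W : finType) (H : {set {set VH}}) (G : {set {set V}}) (K : {set {set W}}) :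
  #|embeddings H G| <= #|embeddings H K| -> Ncopies H G <= Ncopies H K.
Proof.
rewrite (card_embeddings H G) (card_embeddings H K) leq_pmul2r //; apply/card_gt0P.
exists [ffun x => x]; rewrite inE; apply/andP; split.
  by apply/injectiveP => x y; rewrite !ffunE.
apply/forallP => A; apply/implyP => AH.
rewrite (_ : _ @: A = A) //; rewrite -[RHS]imset_id; apply: eq_imset => x.
by rewrite ffunE.
Qed.

(** * Stability *)

Section Stability.
Variables (VF : finType) (F : {set {set VF}}) (r : nat).
Let k := r.+2.
Hypotheses (sF : sgraph F) (critF : has_color_critical_edge F) (chiF : chi F = k.+1).

Let t := #|VF|.

(** The ends p and q of the critical edge are taken from the classes 0 and k, the other vertices
    from the classes below k. Deleting p costs one vertex, hence the size t.+1. *)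
Lemma free_no_blowup (V : finType) (e : rel V) (S : nat -> {set V}) :
  symmetric e -> irreflexive e -> embr F e = set0 ->
  ~ complete_blowup e k.+1 t.+1 setT S.
Proof.
move=> esym eirr free [cS eS].
have {}cS i : i < k.+1 -> #|S i| = t.+1 by case/cS.
have eS' i i' u w : i < k.+1 -> i' < k.+1 -> i != i' -> u \in S i -> w \in S i' -> e u w.
  move=> ik i'k; rewrite neq_ltn => /orP[] lt uS wS.
    by apply: (eS i i'); rewrite // lt.
  by rewrite esym; apply: (eS i' i); rewrite // lt.
have ltk (i : 'I_k) : i < k.+1 by rewrite ltnS ltnW.
have [p pS] : exists p, p \in S 0 by apply/card_gt0P; rewrite cS.
have [q qS] : exists q, q \in S k by apply/card_gt0P; rewrite cS.
suff: embr F e != set0 by rewrite free eqxx.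
apply: (@critical_embedding VF V F k e (fun i => S i :\ p) ord0 p q sF critF chiF esym eirr).
- exact: (eS' 0 k).
- by rewrite !inE eqxx.
- rewrite inE negb_and; apply/orP; right; apply/negP => qS0.
  by have := eS' 0 k q q isT (leqnn _) isT qS0 qS; rewrite eirr.
- move=> i w i0; rewrite inE => /andP[_ wS]; apply/andP; split.
    by apply: (eS' 0 i); rewrite ?ltk // eq_sym.
  by apply: (eS' k i); rewrite ?ltk ?gtn_eqF.
- move=> i i' u w ii'; rewrite !inE => /andP[_ uS] /andP[_ wS].
  by apply: (eS' i i'); rewrite ?ltk.
move=> i; have := cS i (ltk i); rewrite (cardsD1 p).
by case: (p \in S i) => /=; rewrite -/t; lia.
Qed.

Local Open Scope ring_scope.

Lemma free_motzkin_straus (delta : rat) : 0 < delta ->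
  exists n0 : nat, forall (V : finType) (e : rel V),
    symmetric e -> irreflexive e -> embr F e = set0 -> (n0 <= #|V|)%N ->
    motzkin_straus_for e (1 - k%:R^-1) delta.
Proof.
move=> delta0; have [D MS] := @motzkin_straus_approx r.+1 delta delta0.
have [n0 blow] := blowup_of_clique_count k.+1 t.+1 D.
exists n0 => V e esym eirr free n0V x x01.
have -> : \sum_v x v = \sum_(v in setT) x v by apply: eq_bigl => v; rewrite inE.
apply: MS => //; rewrite leqNgt; apply/negP => /ltnW lt.
by have [S] := blow V e setT n0V lt; apply: free_no_blowup.
Qed.

Let alpha : rat := 1 - k%:R^-1.

(** The inequality of Motzkin and Straus is applied to weight 1 - gamma on vertices of low degree
    and 1 elsewhere. With P such vertices, 2 gamma^2 P n <= gamma^3 n^2 + alpha gamma^2 P^2 results,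
    where gamma^3 collects the two errors gamma^3 / 2; finally alpha P^2 <= P n. *)
Lemma few_low_degrees (V : finType) (e : rel V) (gamma : rat) :
  symmetric e -> 0 < gamma <= 1 -> (0 < #|V|)%N ->
  motzkin_straus_for e alpha (gamma ^+ 3 / 2) ->
  (alpha - gamma ^+ 3 / 2) * #|V|%:R ^+ 2 <= \sum_u #|nbhd e u|%:R ->
  #|[set u | #|nbhd e u|%:R < (alpha - gamma) * #|V|%:R :> rat]|%:R <= gamma * #|V|%:R.
Proof.
move=> esym /andP[g0 g1] V_gt0 ms leW.
set N : rat := #|V|%:R in leW *; have N_gt0 : 0 < N by rewrite ltr0n.
set Low := [set u | _]; set P : rat := #|Low|%:R.
have P0 : 0 <= P by rewrite ler0n.
have PN : P <= N by rewrite ler_nat max_card.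
pose c u : rat := (u \in Low)%:R * gamma; pose x u : rat := 1 - c u.
have c01 u : 0 <= c u <= 1.
  by rewrite /c; case: (u \in Low); rewrite ?mul1r ?mul0r ?lexx ?ler01 ?(ltW g0).
have x01 u : 0 <= x u <= 1 by have /andP[? ?] := c01 u; rewrite /x; lra.
have sumc : \sum_u c u = P * gamma.
  rewrite -mulr_suml /P -sum1_card natr_sum [in RHS]big_mkcond /=; congr (_ * _).
  by apply: eq_bigr => u _; case: (u \in Low).
have sumx : \sum_u x u = N - P * gamma.
  by rewrite sumrB sumc /N -sum1_card natr_sum.
have := ms x x01; rewrite sumx -/N.
have dle : \sum_u c u * #|nbhd e u|%:R <= P * gamma * ((alpha - gamma) * N).
  rewrite -sumc mulr_suml; apply: ler_sum => u _; rewrite /c; case uL: (u \in Low).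
    by rewrite mul1r ler_wpM2l ?(ltW g0) //; move: uL; rewrite inE => /ltW.
  by rewrite !mul0r.
have qge : \sum_u #|nbhd e u|%:R - (\sum_u c u * #|nbhd e u|%:R) *+ 2 <= qform e setT x.
  have -> : (\sum_u c u * #|nbhd e u|%:R) *+ 2 =
      \sum_u c u * #|nbhd e u|%:R + \sum_u \sum_(w in nbhd e u) c w.
    rewrite mulr2n; congr (_ + _); rewrite (exchange_big_dep predT) //=.
    apply: eq_bigr => w _; rewrite mulr_natr -sumr_const; apply: eq_bigl => u.
    by rewrite !inE esym.
  rewrite -big_split -sumrB /= /qform [leRHS](eq_bigl predT); last by move=> u; rewrite inE.
  apply: ler_sum => u _; rewrite setTI [c u * _]mulr_natr -[c u *+ _]sumr_const -big_split /=.
  rewrite -sum1_card natr_sum -sumrB; apply: ler_sum => w _ /=.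
  have /andP[? ?] := c01 u; have /andP[? ?] := c01 w.
  have : 0 <= c u * c w by rewrite mulr_ge0.
  by rewrite /x; lra.
move=> leq; have : gamma ^+ 2 * (P * N) <= gamma ^+ 2 * (gamma * N * N).
  have a1 : alpha <= 1 by rewrite /alpha lerBlDr lerDl invr_ge0 ler0n.
  have s1 : P * P <= P * N by rewrite ler_wpM2l.
  have s2 : alpha * (gamma ^+ 2 * (P * P)) <= gamma ^+ 2 * (P * N).
    apply: (@le_trans _ _ (1 * (gamma ^+ 2 * (P * P)))).
      by apply: ler_wpM2r a1; apply: mulr_ge0; [exact: sqr_ge0 | exact: mulr_ge0].
    by rewrite mul1r ler_wpM2l ?sqr_ge0.
  by move: qge; rewrite mulr2n => qge; lra.
by rewrite ler_pM2l ?exprn_gt0 // ler_pM2r.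
Qed.

(** Without such a blow-up there are few k-cliques outside of Low, and Motzkin and Straus holds
    there with 1 - 1/(k-1), far below alpha. The errors add up to 4 g0 n^2, one g0 from that
    inequality, two from Low and one from the degree sum, while the gap is 8 g0 n^2. *)
Lemma exists_blowup (T : nat) (g0 := (r.+1%:R^-1 - k%:R^-1) / 8 : rat) :
  exists n0 : nat, forall (V : finType) (e : rel V) (Low : {set V}),
    symmetric e -> (n0 <= #|V|)%N -> #|Low|%:R <= g0 * #|V|%:R ->
    (alpha - g0) * #|V|%:R ^+ 2 <= \sum_u #|nbhd e u|%:R ->
    exists S, complete_blowup e k T (~: Low) S.
Proof.
have gap : 0 < r.+1%:R^-1 - k%:R^-1 :> rat.
  by rewrite subr_gt0 ltf_pV2 ?posrE ?ltr0n // ltr_nat.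
have g0_gt0 : 0 < g0 by rewrite /g0 divr_gt0.
have [D MS] := @motzkin_straus_approx r g0 g0_gt0.
have [n0 blow] := blowup_of_clique_count k T D.
exists n0.+1 => V e Low esym n0V leLow leW.
apply: blow; first exact: ltnW.
have linear_clash (g z M W q s y : rat) : y <= (1 - (z + 8 * g)) * M ->
    q <= y + g * M -> W <= q + (s + s) -> s <= g * M -> (1 - z - g) * M <= W ->
    0 < g * M -> False by move=> *; lra.
set A := ~: Low; rewrite leqNgt; apply/negP => /ltnW lt.
set N : rat := #|V|%:R in leLow leW; have N_gt0 : 0 < N by rewrite ltr0n; apply: leq_ltn_trans n0V.
have one01 (u : V) : 0 <= (1 : rat) <= 1 by rewrite ler01 lexx.
have := MS V e A (fun=> 1) esym one01 lt; rewrite -/N.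
have := qform_split esym one01 (subsetT A).
have -> : qform e setT (fun=> 1) = \sum_u #|nbhd e u|%:R.
  rewrite qformE; apply: eq_big => u; first by rewrite inE.
  by rewrite mul1r setTI -sum1_card natr_sum.
have le1 : \sum_(u in [set: V] :\: A) 1 * \sum_(w in [set: V] :&: nbhd e u) 1 <= g0 * N * N.
  apply: (@le_trans _ _ (\sum_(u in [set: V] :\: A) N)).
    by apply: ler_sum => u _; rewrite mul1r; apply: sum_weight_leV one01 _.
  rewrite sumr_const -[N *+ _]mulr_natl ler_wpM2r ?(ltW N_gt0) //.
  by rewrite setTD /A setCK.
have le2 : (1 - r.+1%:R^-1) * (\sum_(u in A) 1) ^+ 2 <= (1 - r.+1%:R^-1) * N ^+ 2 :> rat.
  rewrite ler_wpM2l ?subr_ge0 ?invf_le1 ?ler1n ?ltr0n //.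
  rewrite lerXn2r ?nnegrE ?(ltW N_gt0) //; first by apply: sumr_ge0.
  exact: sum_weight_leV one01 _.
rewrite mulr2n => le3 le4.
have gM : 0 < g0 * N ^+ 2 by rewrite mulr_gt0 // exprn_gt0.
have g8 : r.+1%:R^-1 = k%:R^-1 + 8 * g0 by rewrite /g0 [8 * _]mulrC divfK // addrC subrK.
rewrite -mulrA -expr2 in le1; rewrite g8 in le2 le4.
exact: linear_clash le2 le4 le3 le1 leW gM.
Qed.

Local Close Scope ring_scope.

(** Otherwise v and a neighbour q in class 0 could serve as the critical edge, with the neighbours
    of v in the classes as colour classes; deleting q still leaves t of them in each. *)
Lemma few_neighbours_in_some_class (V : finType) (e : rel V) (U : 'I_k -> {set V}) (v : V) :
  symmetric e -> irreflexive e -> embr F e = set0 ->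
  (forall i i' u w, i != i' -> u \in U i -> w \in U i' -> e u w) ->
  exists i, #|nbhd e v :&: U i| <= t.
Proof.
move=> esym eirr free eU; apply/existsP; rewrite -[[exists _, _]]negbK negb_exists.
apply/negP => /forallP many.
have {}many i : t < #|nbhd e v :&: U i| by rewrite ltnNge.
have [q] : exists q, q \in nbhd e v :&: U ord0.
  by apply/card_gt0P; apply: leq_ltn_trans (many _).
rewrite !inE => /andP[evq qU].
suff: embr F e != set0 by rewrite free eqxx.
apply: (@critical_embedding VF V F k e (fun i => (nbhd e v :&: U i) :\ q) ord0 v q
  sF critF chiF esym eirr evq).
- by rewrite !inE eirr andbF.
- by rewrite !inE eqxx.
- move=> i w i0; rewrite !inE => /and3P[_ evw wU]; rewrite evw.
  by apply: (eU ord0 i); rewrite // eq_sym.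
- move=> i i' u w ii'; rewrite !inE => /and3P[_ _ uU] /and3P[_ _ wU].
  exact: (eU i i').
move=> i; have := many i; rewrite (cardsD1 q) -/t.
by case: (q \in _) => /=; lia.
Qed.

(** Two sets of more than 2 T elements in a class of size 3 T share more than T. So u v could serve
    as the critical edge, with common neighbours in the classes other than j and with class j
    itself, u and v removed. *)
Lemma no_edge_in_class (V : finType) (e : rel V) (U : 'I_k -> {set V}) T (j : 'I_k) (u v : V) :
  symmetric e -> irreflexive e -> embr F e = set0 ->
  (forall i i' u w, i != i' -> u \in U i -> w \in U i' -> e u w) ->
  (forall i, #|U i| = 3 * T) -> t.+2 <= T ->
  (forall i, i != j -> 2 * T < #|nbhd e u :&: U i|) ->
  (forall i, i != j -> 2 * T < #|nbhd e v :&: U i|) -> ~~ e u v.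
Proof.
move=> esym eirr free eU cU tT du dv; apply/negP => euv.
pose S i := if i == j then U j :\ u :\ v else nbhd e u :&: nbhd e v :&: U i.
have SU i : S i \subset U i.
  rewrite /S; case: eqVneq => [->|_]; last exact: subsetIr.
  by rewrite !subDset; apply: subsetU; rewrite subsetUr orbT.
suff: embr F e != set0 by rewrite free eqxx.
apply: (@critical_embedding VF V F k e S j u v sF critF chiF esym eirr euv).
- by rewrite /S eqxx !inE eqxx andbF.
- by rewrite /S eqxx !inE eqxx.
- by move=> i w /negbTE ij; rewrite /S ij !inE => /andP[].
- by move=> i i' x w ii' /(subsetP (SU i)) xU /(subsetP (SU i')) wU; apply: (eU i i').
move=> i; rewrite /S; case: eqVneq => [_|ij].
  have := cU j; rewrite (cardsD1 u) (cardsD1 v (_ :\ _)) -/t.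
  by move: (u \in _) (v \in _) => [] [] /=; lia.
have := cardsUI (nbhd e u :&: U i) (nbhd e v :&: U i).
have -> : nbhd e u :&: U i :&: (nbhd e v :&: U i) = nbhd e u :&: nbhd e v :&: U i.
  by rewrite setIACA setIid.
have : #|nbhd e u :&: U i :|: nbhd e v :&: U i| <= 3 * T.
  by rewrite -(cU i) subset_leq_card // subUset !subsetIr.
have := du i ij; have := dv i ij; rewrite -/t; lia.
Qed.

(** Each vertex gets a class in which it has at most t neighbours; it is exceptional if it has at
    most 2 T of the 3 T possible neighbours in some other class. Exceptional vertices are few by
    double counting the edges between V and the U i, since the vertices of the U i have degree
    nearly alpha n. *)
Lemma blowup_coloring (V : finType) (e : rel V) (U : 'I_k -> {set V}) T (gamma : rat) :
  symmetric e -> irreflexive e -> embr F e = set0 ->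
  (forall i i' u w, i != i' -> u \in U i -> w \in U i' -> e u w) ->
  (forall i, #|U i| = 3 * T) -> t.+2 <= T ->
  (forall i u, u \in U i -> (alpha - gamma) * #|V|%:R <= #|nbhd e u|%:R)%R ->
  exists (phi : V -> 'I_k) (Exc : {set V}),
    (T%:R * #|Exc|%:R <= (t%:R + 3 * k%:R * T%:R * gamma) * #|V|%:R :> rat)%R /\
    forall u v, e u v -> phi u = phi v -> (u \in Exc) || (v \in Exc).
Proof.
move=> esym eirr free eU cU tT degU.
pose phi v : 'I_k := odflt ord0 [pick i | #|nbhd e v :&: U i| <= t].
have phiP v : #|nbhd e v :&: U (phi v)| <= t.
  rewrite /phi; case: pickP => //= none.
  by have [i] := few_neighbours_in_some_class v esym eirr free eU; rewrite none.
pose Exc := [set v | [exists i, (i != phi v) && (#|nbhd e v :&: U i| <= 2 * T)]].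
exists phi, Exc; split; last first.
  move=> u v euv phiuv; rewrite -[_ || _]negbK negb_or !inE !negb_exists.
  apply/negP => /andP[/forallP uE /forallP vE].
  have /negP : ~~ e u v; last by rewrite euv.
  apply: (no_edge_in_class (j := phi u) esym eirr free eU cU tT) => i iu.
    by have := uE i; rewrite iu -ltnNge.
  by have := vE i; rewrite -phiuv iu -ltnNge.
have others v : \sum_(i | i != phi v) 3 * T = r.+1 * (3 * T).
  by rewrite sum_nat_const cardC1 card_ord.
have leU v i : #|nbhd e v :&: U i| <= 3 * T by rewrite -(cU i) subset_leq_card // subsetIr.
have le1 v : \sum_i #|nbhd e v :&: U i| + (v \in Exc) * T <= t + r.+1 * (3 * T).
  rewrite (bigD1 (phi v)) //= -(others v) -addnA leq_add //.
  case vE: (v \in Exc); last by rewrite addn0; apply: leq_sum.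
  move: vE; rewrite inE => /existsP[i /andP[iv le2T]].
  rewrite (bigD1 i) //= [leqRHS](bigD1 i) //= mul1n addnAC leq_add //; first lia.
  exact: leq_sum.
have le2 : \sum_i \sum_(u in U i) #|nbhd e u| + #|Exc| * T <= #|V| * (t + r.+1 * (3 * T)).
  have -> : \sum_i \sum_(u in U i) #|nbhd e u| = \sum_v \sum_i #|nbhd e v :&: U i|.
    rewrite [RHS]exchange_big; apply: eq_bigr => i _ /=.
    transitivity (\sum_(u in U i) \sum_(v in nbhd e u) 1).
      by apply: eq_bigr => u _; rewrite sum1_card.
    rewrite (exchange_big_dep predT) //=; apply: eq_bigr => v _; rewrite -sum1_card.
    by apply: eq_bigl => u; rewrite !inE esym andbC.
  have -> : #|Exc| * T = \sum_v (v \in Exc) * T.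
    rewrite -sum1_card big_mkcond big_distrl /=; apply: eq_bigr => v _.
    by case: (v \in Exc).
  rewrite -big_split /= -sum_nat_const; exact: leq_sum.
move: le2; rewrite -(ler_nat rat) => le2.
have le3 : (k%:R * (3 * T)%:R * ((alpha - gamma) * #|V|%:R) <=
    (\sum_i \sum_(u in U i) #|nbhd e u|)%N%:R :> rat)%R.
  rewrite natr_sum -[k in k%:R%R]card_ord -sum1_card natr_sum !mulr_suml; apply: ler_sum => i _.
  rewrite mul1r natr_sum -(cU i) -sum1_card natr_sum mulr_suml; apply: ler_sum => u uU.
  by rewrite mul1r (degU i).
move: le2; rewrite natrD !natrM natrD natrM => le2.
(* As k * alpha = k - 1, the main term of the degree sum cancels against the r.+1 classes that a
   vertex may be fully joined to. *)
have kE : (k%:R * alpha = r.+1%:R :> rat)%R.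
  rewrite /alpha mulrBr mulr1 divff ?pnatr_eq0 //.
  by rewrite /k -[r.+2]addn1 natrD addrK.
have le4 : ((k%:R * alpha) * (3 * T%:R * #|V|%:R) - k%:R * 3 * T%:R * gamma * #|V|%:R <=
    (\sum_i \sum_(u in U i) #|nbhd e u|)%N%:R :> rat)%R.
  by apply: le_trans le3; rewrite natrM; lra.
by rewrite kE in le4; rewrite natrM in le2; lra.
Qed.

Local Open Scope ring_scope.

Lemma stability (beta : rat) : 0 < beta ->
  exists2 gamma : rat, 0 < gamma & exists n0 : nat, forall (V : finType) (e : rel V),
    symmetric e -> irreflexive e -> embr F e = set0 -> (n0 <= #|V|)%N ->
    (alpha - gamma) * #|V|%:R ^+ 2 <= \sum_u #|nbhd e u|%:R ->
    exists phi : V -> 'I_k,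
      (\sum_u #|[set w | e u w && (phi u == phi w)]|)%:R <= beta * #|V|%:R ^+ 2.
Proof.
move=> beta0; pose g0 : rat := (r.+1%:R^-1 - k%:R^-1) / 8.
have k_gt0 : 0 < k%:R :> rat by rewrite ltr0n.
have g0_gt0 : 0 < g0.
  by rewrite divr_gt0 // subr_gt0 ltf_pV2 ?posrE ?ltr0n // ltr_nat.
(* With T * beta >= 4 t below, g1 gives |Exc| <= beta / 2 * n: both t and 3 * k * T * g1 are at most
   T * beta / 4. Every monochromatic edge meets Exc, and edges are counted from both ends. *)
pose g1 := Num.min 1 (Num.min (beta / (12 * k%:R)) g0).
have g1_gt0 : 0 < g1 by rewrite !lt_min ltr01 g0_gt0 divr_gt0 // mulr_gt0.
have g1_le1 : g1 <= 1 by rewrite ge_min lexx.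
have g1_leb : 12 * k%:R * g1 <= beta.
  by rewrite mulrC -ler_pdivlMr ?mulr_gt0 // !ge_min lexx !orbT.
have g1_leg : g1 <= g0 by rewrite !ge_min lexx !orbT.
have g3 : g1 ^+ 3 / 2 <= g1.
  have : g1 ^+ 3 <= g1 by rewrite exprS ler_piMr ?(ltW g1_gt0) // exprn_ile1 // ltW.
  by lra.
have g3_gt0 : 0 < g1 ^+ 3 / 2 by rewrite divr_gt0 // exprn_gt0.
have [m lem] := rat_nat_bound (4 * t%:R / beta).
pose T := (t.+2 + m)%N.
have leT : 4 * t%:R <= T%:R * beta.
  rewrite -ler_pdivrMr //; apply: le_trans lem _.
  by rewrite ler_nat leq_addl.
have [n1 MS] := free_motzkin_straus g3_gt0; have [n2 blow] := exists_blowup (3 * T).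
exists (g1 ^+ 3 / 2) => //; exists (n1 + n2).+1 => V e esym eirr free nV leW.
have V_gt0 : (0 < #|V|)%N by apply: leq_ltn_trans nV.
set N : rat := #|V|%:R in leW *; have N_gt0 : 0 < N by rewrite ltr0n.
have ms : motzkin_straus_for e alpha (g1 ^+ 3 / 2).
  by apply: MS => //; apply: leq_trans (ltnW nV); rewrite leq_addr.
have := few_low_degrees esym _ V_gt0 ms leW; rewrite g1_gt0 g1_le1 => /(_ isT).
set Low := [set u | _] => leLow.
have [||| S [cS eS]] := blow V e Low esym.
- by apply: leq_trans (ltnW nV); rewrite leq_addl.
- by apply: le_trans leLow _; rewrite ler_wpM2r // ltW.
- apply: le_trans leW; rewrite ler_wpM2r ?sqr_ge0 //.
  by rewrite lerD2l lerN2 (le_trans g3).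
pose U (i : 'I_k) := S i.
have eU (i i' : 'I_k) u w : i != i' -> u \in U i -> w \in U i' -> e u w.
  rewrite -val_eqE neq_ltn => /orP[] lt uS wS.
    by apply: (eS i i'); rewrite // lt /=.
  by rewrite esym; apply: (eS i' i); rewrite // lt /=.
have cU i : #|U i| = (3 * T)%N by have [_] := cS i (ltn_ord i).
have degU (i : 'I_k) u : u \in U i -> (alpha - g1) * N <= #|nbhd e u|%:R.
  have [/subsetP sub _] := cS i (ltn_ord i).
  by move=> /sub; rewrite !inE -leNgt.
have tT : (t.+2 <= T)%N by rewrite leq_addr.
have [phi [Exc [leE inE']]] := blowup_coloring esym eirr free eU cU tT degU.
exists phi; rewrite -/N in leE.
have T_gt0 : 0 < T%:R :> rat by rewrite ltr0n.
have leExc : #|Exc|%:R <= beta / 2 * N.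
  rewrite -(ler_pM2l T_gt0) mulrA; apply: le_trans leE _.
  rewrite ler_wpM2r ?(ltW N_gt0) //.
  have : T%:R * (12 * k%:R * g1) <= T%:R * beta by rewrite ler_wpM2l // ltW.
  by lra.
apply: (@le_trans _ _ (#|Exc| * #|V| + #|V| * #|Exc|)%:R); last first.
  rewrite natrD !natrM -/N.
  have : #|Exc|%:R * N <= beta / 2 * N * N by rewrite ler_wpM2r // ltW.
  by lra.
rewrite ler_nat; apply: (@leq_trans (\sum_u ((u \in Exc) * #|V| + #|Exc|))).
  apply: leq_sum => u _; case uE: (u \in Exc).
    by rewrite mul1n; apply: leq_trans (max_card _) (leq_addr _ _).
  rewrite mul0n add0n; apply: subset_leq_card; apply/subsetP => w.
  by rewrite inE => /andP[euw /eqP phiE]; have := inE' u w euw phiE; rewrite uE.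
rewrite big_split /= sum_nat_const leq_add2r -big_distrl leq_mul2r; apply/orP; right.
rewrite -sum1_card [leqRHS]big_mkcond; apply: leq_sum => u _; by case: (u \in Exc).
Qed.

End Stability.

Local Close Scope ring_scope.

(** * Edges inside of the colour classes *)

Section Defects.
Variables (V Q : finType) (e : rel V).
Hypotheses (esym : symmetric e) (eirr : irreflexive e).
Implicit Type phi : V -> Q.

Definition inner phi u : nat := #|[set w | e u w && (phi u == phi w)]|.
Definition missing phi u : nat := #|[set w | ~~ e u w && (phi u != phi w)]|.
Definition part phi c : {set V} := [set u | phi u == c].

Lemma eq_inner phi psi : phi =1 psi -> inner phi =1 inner psi.
Proof. by move=> eq u; apply: eq_card => w; rewrite !inE !eq. Qed.

(** The second sum does not depend on the colour of v, which isolates the effect of recolouring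
    v. *)
Lemma sum_inner_split phi v :
  \sum_u inner phi u = 2 * inner phi v +
    \sum_(u | u != v) #|[set w | [&& w != v, e u w & phi u == phi w]]|.
Proof.
rewrite (bigD1 v) //= mul2n -addnn -addnA; congr (_ + _).
transitivity (\sum_(u | u != v) ((e v u && (phi v == phi u)) +
    #|[set w | [&& w != v, e u w & phi u == phi w]]|)).
  apply: eq_bigr => u uv; rewrite /inner (cardsD1 v) !inE esym [phi v == _]eq_sym; congr (_ + _).
  by apply: eq_card => w; rewrite !inE.
rewrite big_split /=; congr (_ + _).
rewrite /inner -sum1dep_card big_mkcond [RHS]big_mkcond /=; apply: eq_bigr => u _.
by case: (eqVneq u v) => [->|_] /=; rewrite ?eirr //; case: (_ && _).
Qed.

(** A colouring with the fewest monochromatic edges: giving v the colour c would turn its inner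
    degree into its number of neighbours in part c. *)
Lemma exists_optimal_coloring phi0 :
  exists2 phi, \sum_u inner phi u <= \sum_u inner phi0 u &
    forall v c, inner phi v <= #|nbhd e v :&: part phi c|.
Proof.
pose f0 := [ffun u => phi0 u].
case: (arg_minnP (P := predT) (fun f : {ffun V -> Q} => \sum_u inner f u)
        (erefl : predT f0)) => f _ min_f.
exists f => [|v c].
  apply: leq_trans (min_f f0 isT) _; apply: eq_leq; apply: eq_bigr => u _.
  by apply: eq_inner => w; rewrite ffunE.
pose f' := [ffun u => if u == v then c else f u].
have := min_f f' isT; rewrite !(sum_inner_split _ v).
have -> : \sum_(u | u != v) #|[set w | [&& w != v, e u w & f' u == f' w]]| =
          \sum_(u | u != v) #|[set w | [&& w != v, e u w & f u == f w]]|.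
  apply: eq_bigr => u /negbTE uv; apply: eq_card => w; rewrite !inE !ffunE uv.
  by case: (eqVneq w v).
rewrite leq_add2r leq_pmul2l // => /leq_trans; apply; apply: eq_leq; apply: eq_card => w.
rewrite !inE !ffunE eqxx; case: (eqVneq w v) => [->|_]; rewrite ?eirr //.
by rewrite [c == _]eq_sym.
Qed.

Lemma select_complete phi (B : Q -> {set V}) q z :
  (forall c, B c \subset part phi c) -> (forall c u, u \in B c -> missing phi u <= z) ->
  (forall c, #|Q| * (q * z) + q <= #|B c|) ->
  exists S : Q -> {set V}, (forall c, S c \subset B c /\ #|S c| = q) /\
    (forall c c' u w, c != c' -> u \in S c -> w \in S c' -> e u w).
Proof.
move=> Bpart Bz cB.
have Rsym : symmetric (fun u w => ~~ e u w && (phi u != phi w)).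
  by move=> u w /=; rewrite esym eq_sym.
have [S [S1 S2]] := greedy_selection Rsym Bz cB.
exists S; split=> // c c' u w cc' uS wS.
have := S2 c c' u w cc' uS wS.
have phiE c1 u1 : u1 \in S c1 -> phi u1 = c1.
  have [/subsetP sub _] := S1 c1; move=> /sub/(subsetP (Bpart c1)).
  by rewrite inE => /eqP.
by rewrite (phiE _ _ uS) (phiE _ _ wS) cc' andbT negbK.
Qed.

End Defects.

Section Cleanup.
Variables (VF : finType) (F : {set {set VF}}) (k : nat).
Hypotheses (sF : sgraph F) (critF : has_color_critical_edge F) (chiF : chi F = k.+1).
Hypothesis k_gt0 : 0 < k.
Let t := #|VF|.

Variables (V : finType) (e : rel V) (phi : V -> 'I_k) (m : nat).
Hypotheses (esym : symmetric e) (eirr : irreflexive e) (free : embr F e = set0).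
Hypothesis phi_opt : forall v c, inner e phi v <= #|nbhd e v :&: part phi c|.
Hypothesis m_gt0 : 0 < m.
Hypothesis few_missing : m * m * \sum_u missing e phi u <= #|V| ^ 2.
Hypothesis large_parts : forall c, #|V| <= 2 * k * #|part phi c|.
Let n := #|V|.
Let y := n %/ m.
Let Typ := [set u | missing e phi u <= y].

(** Markov: an atypical vertex misses more than n / m others, while m * m times the sum is at most
    n^2. *)
Lemma few_atypical : #|~: Typ| <= y.
Proof.
rewrite /y leq_divRL //.
have [n0|n_gt0] := posnP n.
  by have := max_card (mem (~: Typ)); rewrite -/n n0 leqn0 => /eqP ->.
have le1 : #|~: Typ| * n <= m * \sum_u missing e phi u.
  rewrite -sum_nat_const big_distrr /= [leqLHS]big_mkcond; apply: leq_sum => u _.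
  rewrite !inE; case: (leqP (missing e phi u) y) => // lt_y.
  by rewrite mulnC; apply: ltnW; rewrite -ltn_divLR.
rewrite -(leq_pmul2r n_gt0) [n * n]mulnn; apply: leq_trans few_missing.
by rewrite mulnAC mulnC -mulnA leq_mul2l le1 orbT.
Qed.

Lemma card_typical (A : {set V}) : #|A| <= #|A :&: Typ| + y.
Proof.
rewrite -(cardsID Typ A) leq_add2l; apply: leq_trans few_atypical.
by apply: subset_leq_card; apply/subsetP => u; rewrite !inE => /andP[].
Qed.

(** If v had n / d neighbours in its own class, by optimality it would have as many in every class.
    Typical ones among them contain a complete k-partite graph with t.+1 vertices in each part; v
    and one vertex of it then serve as the critical edge. *)
Lemma inner_degree_small d v : 0 < d -> 2 * d * (k * t.+1).+1 <= m -> 2 * d * t.+1 <= n ->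
  d * inner e phi v < n.
Proof.
move=> d_gt0 dm dn; rewrite ltnNge; apply/negP => large.
have ym : y * m <= n by rewrite leq_divM.
pose B c := (nbhd e v :&: part phi c) :&: Typ.
have [|c u|c|S [S1 S2]] := @select_complete V _ e esym phi B t.+1 y.
- by move=> c; apply: subset_trans (subsetIl _ _) (subsetIr _ _).
- by rewrite !inE => /andP[].
- rewrite card_ord; have := card_typical (nbhd e v :&: part phi c); rewrite -/(B c).
  have := phi_opt v c; set D := #|nbhd e v :&: _|; set b := #|B c| => leD leb.
  suff : 2 * d * (k * (t.+1 * y) + t.+1 + y) <= 2 * d * D by rewrite leq_pmul2l; lia.
  have : 2 * d * (k * t.+1).+1 * y <= n.
    by apply: leq_trans ym; rewrite mulnC leq_mul2l dm orbT.
  have : n <= d * D by apply: leq_trans large _; rewrite leq_mul2l leD orbT.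
  nia.
pose j : 'I_k := Ordinal k_gt0.
have vS c w : w \in S c -> e v w.
  by have [/subsetP sub _] := S1 c; move=> /sub; rewrite !inE => /andP[/andP[]].
have [q qS] : exists q, q \in S j by apply/card_gt0P; have [_ ->] := S1 j.
suff: embr F e != set0 by rewrite free eqxx.
apply: (@critical_embedding VF V F k e (fun c => S c :\ q) j v q) => //.
- exact: vS qS.
- by rewrite !inE negb_and; apply/orP; right; apply/negP => /vS; rewrite eirr.
- by rewrite !inE eqxx.
- move=> i w ij; rewrite inE => /andP[_ wS]; rewrite (vS _ _ wS).
  by apply: (S2 j i); rewrite // eq_sym.
- by move=> i i' u w ii'; rewrite !inE => /andP[_ uS] /andP[_ wS]; apply: (S2 i i').
move=> i; have [_] := S1 i; rewrite (cardsD1 q) -/t.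
by case: (q \in S i) => /=; lia.
Qed.

(** Parts have at least n / (2 k) vertices. If u and v each miss at most n / (8 k), they keep n / (4
    k) common neighbours in every other part; a complete k-partite graph is selected there and in
    their own part, and u v serves as the critical edge. *)
Lemma inner_edge_missing u v : 8 * k * (k * t.+1).+1 <= m -> 8 * k * (t.+1 + 2) <= n ->
  e u v -> phi u = phi v -> (n < 8 * k * missing e phi u) || (n < 8 * k * missing e phi v).
Proof.
move=> km kn euv phiE; rewrite -[_ || _]negbK negb_or -!leqNgt; apply/negP => /andP[mu mv].
have ym : y * m <= n by rewrite leq_divM.
have kym : 8 * k * (k * t.+1).+1 * y <= n.
  by apply: leq_trans ym; rewrite mulnC leq_mul2l km orbT.
set j := phi u in phiE.
pose A c := if c == j then part phi j :\ u :\ v else nbhd e u :&: nbhd e v :&: part phi c.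
have largeA c : 2 * n <= 8 * k * (#|A c| + 2).
  have := large_parts c; rewrite /A; case: eqVneq => [->|cj].
    have := cardsD1 u (part phi j); have := cardsD1 v (part phi j :\ u).
    move: (u \in _) (v \in _) => [] [] /=; rewrite -/n; nia.
  have sub : part phi c \subset (nbhd e u :&: nbhd e v :&: part phi c) :|:
      ([set w | ~~ e u w && (phi u != phi w)] :|: [set w | ~~ e v w && (phi v != phi w)]).
    apply/subsetP => w; rewrite !inE => /eqP ->; rewrite -phiE -/j eq_sym cj eqxx !andbT.
    by case: (e u w); case: (e v w).
  have le1 := leq_trans (subset_leq_card sub) (leq_card_setU _ _).
  have le2 := leq_trans le1 (leq_add (leqnn _) (leq_card_setU _ _)).
  rewrite -/n; move: le2 mu mv; rewrite -/(missing e phi u) -/(missing e phi v).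
  move: #|part _ _| #|_ :&: _| (missing e phi u) (missing e phi v) => p a x z le2 mu mv np.
  have : 8 * k * p <= 8 * k * (a + (x + z)) by rewrite leq_mul2l le2 orbT.
  by rewrite !mulnDr; lia.
pose B c := A c :&: Typ.
have [|c w|c|S [S1 S2]] := @select_complete V _ e esym phi B t.+1 y.
- move=> c; apply: subset_trans (subsetIl _ _) _; rewrite /A; case: eqVneq => [->|_].
    by rewrite !subDset; apply: subsetU; rewrite subsetUr orbT.
  exact: subsetIr.
- by rewrite !inE => /andP[].
- rewrite card_ord; have := card_typical (A c); rewrite -/(B c).
  have := largeA c; set a := #|A c|; set b := #|B c| => lea leb.
  suff : 8 * k * (k * (t.+1 * y) + t.+1 + y + 2) <= 8 * k * (a + 2).
    by rewrite leq_pmul2l ?muln_gt0 //; lia.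
  by nia.
have SA c : S c \subset A c by have [sub _] := S1 c; apply: subset_trans sub (subsetIl _ _).
suff: embr F e != set0 by rewrite free eqxx.
apply: (@critical_embedding VF V F k e S j u v) => //.
- by apply/negP => /(subsetP (SA j)); rewrite /A eqxx !inE eqxx andbF.
- by apply/negP => /(subsetP (SA j)); rewrite /A eqxx !inE eqxx.
- by move=> i w /negbTE ij /(subsetP (SA i)); rewrite /A ij !inE => /andP[].
by move=> i; have [_ ->] := S1 i.
Qed.

End Cleanup.

(** * Embeddings gained and lost *)

Lemma card_ffun_in (VH V : finType) (A : VH -> {set V}) :
  #|[set f : {ffun VH -> V} | [forall z, f z \in A z]]| = \prod_z #|A z|.
Proof.
transitivity #|family (fun z => mem (A z))|.
  by apply: eq_card => f; rewrite inE; apply/forallP/familyP.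
by rewrite card_family foldrE big_map big_enum.
Qed.

Lemma prod_two (I : finType) (x y : I) (f : I -> nat) c : x != y -> f x = 1 -> f y = 1 ->
  (forall z, z != x -> z != y -> f z = c) -> \prod_z f z = c ^ (#|I| - 2).
Proof.
move=> xy fx fy fz; have yx : y != x by rewrite eq_sym.
rewrite (bigD1 x) //= (bigD1 y) //= fx fy !mul1n.
rewrite (eq_bigr (fun=> c)) => [|z /andP[]]; last exact: fz.
rewrite prod_nat_const; congr (_ ^ _).
have := cardsC [set x; y]; rewrite cards2 xy => <-; rewrite addKn.
by apply: eq_card => z; rewrite !inE negb_or.
Qed.

Lemma card_ffun_fix2 (VH V : finType) (x y : VH) (u w : V) : x != y ->
  #|[set f : {ffun VH -> V} | (f x == u) && (f y == w)]| = #|V| ^ (#|VH| - 2).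
Proof.
move=> xy; have yx : y != x by rewrite eq_sym.
pose A z := if z == x then [set u] else if z == y then [set w] else setT.
transitivity #|[set f : {ffun VH -> V} | [forall z, f z \in A z]]|.
  apply: eq_card => f; rewrite !inE; apply/andP/forallP => [[fx fy] z|fA].
    rewrite /A; case: eqVneq => [->|_]; first by rewrite inE.
    by case: eqVneq => [->|_]; rewrite inE.
  by have := fA x; have := fA y; rewrite /A (negbTE yx) !eqxx !inE.
rewrite card_ffun_in; apply: (prod_two xy).
- by rewrite /A eqxx cards1.
- by rewrite /A (negbTE yx) eqxx cards1.
by move=> z /negbTE zx /negbTE zy; rewrite /A zx zy cardsT.
Qed.

(** Such an embedding sends some pair x, y of H to an edge inside of a class; there are at most h^2
    pairs, and the other h - 2 values are arbitrary. *)
Lemma card_embr_gain (VH V Q : finType) (H : {set {set VH}}) (e : rel V) (phi : V -> Q) :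
  sgraph H ->
  #|embr H e :\: embr H (fun u w => phi u != phi w)| <=
  #|VH| ^ 2 * ((\sum_u inner e phi u) * #|V| ^ (#|VH| - 2)).
Proof.
move=> sH; set D := _ :\: _.
pose M x y := [set f : {ffun VH -> V} | e (f x) (f y) && (phi (f x) == phi (f y))].
have cM x y : x != y -> #|M x y| = (\sum_u inner e phi u) * #|V| ^ (#|VH| - 2).
  move=> xy; rewrite -sum1dep_card.
  rewrite (partition_big (fun f : {ffun VH -> V} => f x) predT) //= big_distrl /=.
  apply: eq_bigr => u _; rewrite (partition_big (fun f : {ffun VH -> V} => f y)
     (fun w => e u w && (phi u == phi w))) /=; last by move=> f /andP[+ /eqP <-].
  rewrite /inner -sum1dep_card big_distrl /=; apply: eq_bigr => w uw.
  rewrite mul1n -(card_ffun_fix2 u w xy) -sum1dep_card; apply: eq_bigl => f.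
  case: (eqVneq (f x) u) => [->|]; rewrite ?andbF //=.
  by case: (eqVneq (f y) w) => [->|]; rewrite ?andbF // uw.
have sub : D \subset \bigcup_(p : VH * VH | p.1 != p.2) M p.1 p.2.
  apply/subsetP => f /setDP[/embrP[fi fe] nK].
  have : ~~ [forall x, forall y, ([set x; y] \in H) ==> (phi (f x) != phi (f y))].
    apply: contra nK => /forallP ph; apply/embrP; split=> // x y xy.
    by have /forallP/(_ y)/implyP := ph x; apply.
  rewrite negb_forall => /existsP[x]; rewrite negb_forall => /existsP[y].
  rewrite negb_imply negbK => /andP[xyH phiE]; apply/bigcupP; exists (x, y) => /=.
    by apply: contraTneq xyH => ->; rewrite -/(gadj H y y) gadj_irr.
  by rewrite inE fe.
apply: leq_trans (subset_leq_card sub) _.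
apply: (@leq_trans (\sum_(p : VH * VH | p.1 != p.2) #|M p.1 p.2|)).
  elim/big_rec2: _ => [|p s S _ le]; first by rewrite cards0.
  by apply: leq_trans (leq_card_setU _ _) _; rewrite leq_add2l.
rewrite [leqLHS](eq_bigr (fun=> (\sum_u inner e phi u) * #|V| ^ (#|VH| - 2))); last first.
  by move=> p p12; apply: cM.
rewrite sum_nat_const leq_mul2r; apply/orP; right; apply: leq_trans (max_card _) _.
by rewrite card_prod.
Qed.

(** By the bipartition psi all of H is placed into the parts of v and w. Each vertex other than x0
    and x1 gets its own q candidates; [greedy_selection] for equality, with z = 1, keeps these sets
    disjoint, and the summand 2 makes room for v and w. *)
Lemma card_embr_through (VH V Q : finType) (H : {set {set VH}}) (phi : V -> Q)
    (psi : VH -> bool) (x0 x1 : VH) (v w : V) q :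
  (forall x y, [set x; y] \in H -> psi x != psi y) -> [set x0; x1] \in H ->
  (forall c, #|VH| * q + q + 2 <= #|part phi c|) -> phi v != phi w ->
  q ^ (#|VH| - 2) <=
  #|[set f in embr H (fun u w => phi u != phi w) | (f x0 == v) && (f x1 == w)]|.
Proof.
move=> psiH x01 cpart vw.
have psi01 := psiH _ _ x01.
have neq01 : x0 != x1 by apply: contraNneq psi01 => ->.
have neq10 : x1 != x0 by rewrite eq_sym.
pose c z := if psi z == psi x0 then phi v else phi w.
have cH x y : [set x; y] \in H -> c x != c y.
  by move=> /psiH; rewrite /c; case: (psi x); case: (psi y); case: (psi x0) => //= _;
    rewrite ?[phi w == _]eq_sym.
pose B z := part phi (c z) :\ v :\ w.
have Rsym : symmetric (fun u w : V => u == w) by move=> ? ?; rewrite eq_sym.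
have [z u _|z|S [S1 S2]] := @greedy_selection VH V _ B q 1 Rsym.
- by rewrite (eq_card (B := [set u])) ?cards1 // => a; rewrite !inE eq_sym.
- have := cpart (c z); rewrite muln1 (cardsD1 v) (cardsD1 w (_ :\ _)) -/(B z).
  by move: (v \in _) (w \in _) => [] [] /=; lia.
pose A z := if z == x0 then [set v] else if z == x1 then [set w] else S z.
have <- : #|[set f : {ffun VH -> V} | [forall z, f z \in A z]]| = q ^ (#|VH| - 2).
  rewrite card_ffun_in; apply: (prod_two neq01).
  - by rewrite /A eqxx cards1.
  - by rewrite /A (negbTE neq10) eqxx cards1.
  by move=> z /negbTE z0 /negbTE z1; rewrite /A z0 z1; have [_] := S1 z.
apply: subset_leq_card; apply/subsetP => f; rewrite !inE => /forallP fA.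
have f0 : f x0 = v by have := fA x0; rewrite /A eqxx inE => /eqP.
have f1 : f x1 = w by have := fA x1; rewrite /A (negbTE neq10) eqxx inE => /eqP.
have fS z : z != x0 -> z != x1 -> f z \in S z.
  by move=> /negbTE z0 /negbTE z1; have := fA z; rewrite /A z0 z1.
have fB z : z != x0 -> z != x1 -> [/\ f z != v, f z != w & phi (f z) = c z].
  move=> z0 z1; have [/subsetP sub _] := S1 z.
  by have /sub := fS z z0 z1; rewrite !inE => /and3P[-> -> /eqP].
have fc z : phi (f z) = c z.
  case: (eqVneq z x0) => [->|z0]; first by rewrite f0 /c eqxx.
  case: (eqVneq z x1) => [->|z1]; last by have [] := fB z z0 z1.
  by rewrite f1 /c eq_sym (negbTE psi01).
rewrite f0 f1 !eqxx !andbT; apply/andP; split; last first.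
  by apply/forallP => x; apply/forallP => y; apply/implyP; rewrite !fc; apply: cH.
have vw' : v != w by apply: contraNneq vw => ->.
apply/injectiveP => x y.
case: (eqVneq x x0) => [->|xx0]; case: (eqVneq y x0) => [-> //|yx0].
- rewrite f0; case: (eqVneq y x1) => [->|yx1] /eqP; first by rewrite f1 (negbTE vw').
  by have [+ _ _] := fB y yx0 yx1; rewrite eq_sym => /negbTE ->.
- rewrite f0; case: (eqVneq x x1) => [->|xx1] /eqP; first by rewrite f1 eq_sym (negbTE vw').
  by have [/negbTE -> _ _] := fB x xx0 xx1.
case: (eqVneq x x1) => [->|xx1]; case: (eqVneq y x1) => [-> //|yx1].
- by rewrite f1 => /eqP; have [_ + _] := fB y yx0 yx1; rewrite eq_sym => /negbTE ->.
- by rewrite f1 => /eqP; have [_ /negbTE -> _] := fB x xx0 xx1.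
move=> fxy; apply: contraTeq isT => xy.
by have := S2 x y _ _ xy (fS x xx0 xx1) (fS y yx0 yx1); rewrite fxy eqxx.
Qed.

(** Embeddings of the multipartite graph that send x0, x1 to a missing pair are not embeddings for
    e, and different ordered pairs give different embeddings. *)
Lemma card_embr_loss (VH V Q : finType) (H : {set {set VH}}) (e : rel V) (phi : V -> Q)
    (psi : VH -> bool) (x0 x1 : VH) (Hi : {set V}) q :
  (forall x y, [set x; y] \in H -> psi x != psi y) -> [set x0; x1] \in H ->
  (forall c, #|VH| * q + q + 2 <= #|part phi c|) ->
  (\sum_(u in Hi) missing e phi u) * q ^ (#|VH| - 2) <=
  #|embr H (fun u w => phi u != phi w) :\: embr H e|.
Proof.
move=> psiH x01 cpart; rewrite -[leqRHS]sum1_card.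
rewrite (partition_big (fun f : {ffun VH -> V} => f x0) predT) //= big_distrl /=.
rewrite big_mkcond; apply: leq_sum => v _; case: ifP => // _.
rewrite (partition_big (fun f : {ffun VH -> V} => f x1) predT) //=.
rewrite /missing -sum1dep_card big_distrl big_mkcond /=; apply: leq_sum => w _.
case: ifP => // /andP[nvw vw]; rewrite mul1n.
apply: leq_trans (card_embr_through psiH x01 cpart vw) _.
rewrite sum1dep_card; apply: subset_leq_card; apply/subsetP => f.
rewrite 2!inE => /andP[fK /andP[f0 f1]]; rewrite !inE in fK *; rewrite f0 f1 fK !andbT /=.
apply/negP => /andP[_ /forallP/(_ x0)/forallP/(_ x1)].
by rewrite x01 (eqP f0) (eqP f1) (negbTE nvw).
Qed.

Section CleanupBound.
Variables (VF VH : finType) (F : {set {set VF}}) (H : {set {set VH}}) (k : nat).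
Hypotheses (sF : sgraph F) (critF : has_color_critical_edge F) (chiF : chi F = k.+1).
Hypotheses (k_gt0 : 0 < k) (sH : sgraph H).
Variables (psi : VH -> bool) (x0 x1 : VH).
Hypotheses (psiH : forall x y, [set x; y] \in H -> psi x != psi y) (x01 : [set x0; x1] \in H).

(** Let I be the sum of all inner degrees and M the sum of [missing] over Hi. An edge inside of a
    class has an end in Hi; every inner degree is below n / d, and a vertex of Hi misses more than n
    / (8 k). Hence d * I <= 16 * k * M. The gain is at most h^2 * I * n^(h-2), the loss at least M *
    q^(h-2) with n <= c * q, and d is chosen to absorb all factors. *)
Lemma embr_le_multipartite : exists m n0, [/\ 0 < m &
  forall (V : finType) (e : rel V) (phi : V -> 'I_k),
    symmetric e -> irreflexive e -> embr F e = set0 -> n0 <= #|V| ->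
    (forall v c, inner e phi v <= #|nbhd e v :&: part phi c|) ->
    m * m * \sum_u missing e phi u <= #|V| ^ 2 ->
    (forall c, #|V| <= 2 * k * #|part phi c|) ->
    #|embr H e| <= #|embr H (fun u w => phi u != phi w)|].
Proof.
set t := #|VF|; set h := #|VH|; pose c := 8 * k * h.+1.
have h_gt0 : 0 < h by apply/card_gt0P; exists x0.
pose d := 16 * k * h ^ 2 * c ^ (h - 2).
have c_gt0 : 0 < c by rewrite !muln_gt0 k_gt0.
have d_gt0 : 0 < d by rewrite !muln_gt0 k_gt0 !expn_gt0 h_gt0 c_gt0.
pose m := 2 * d * (k * t.+1).+1 + 8 * k * (k * t.+1).+1.
have m_gt0 : 0 < m by rewrite /m addn_gt0 muln_gt0 muln_gt0 d_gt0.
exists m, (2 * d * t.+1 + 8 * k * (t.+1 + 2) + c); split=> //.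
move=> V e phi esym eirr free nV opt few large; set n := #|V| in nV few large.
pose Hi := [set u | n < 8 * k * missing e phi u].
have small v : d * inner e phi v < n.
  apply: (inner_degree_small sF critF chiF k_gt0 esym eirr free opt m_gt0 few); rewrite -/t //.
    by rewrite leq_addr.
  by rewrite -/n; lia.
have inHi u w : e u w -> phi u = phi w -> (u \in Hi) || (w \in Hi).
  move=> euw phiE; rewrite !inE.
  apply: (inner_edge_missing sF critF chiF k_gt0 esym eirr free m_gt0 few large) => //.
    by rewrite leq_addl.
  by rewrite -/n -/t; lia.
pose q := n %/ (4 * k * h.+1).
have k4 : 0 < 4 * k * h.+1 by rewrite !muln_gt0 k_gt0.
have qle : q * (4 * k * h.+1) <= n by rewrite leq_divM.
have qge : n <= c * q.
  have q1 : 0 < q by rewrite divn_gt0 //; apply: leq_trans nV; rewrite /c; lia.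
  have := ltn_ceil n k4; rewrite -/q /c; nia.
have cpart a : h * q + q + 2 <= #|part phi a|.
  rewrite -(@leq_pmul2l (2 * k)) ?muln_gt0 ?k_gt0 //; apply: leq_trans (large a).
  by rewrite -(@leq_pmul2l 2) //; move: nV qle; rewrite /c; nia.
have lossle := card_embr_loss e Hi psiH x01 cpart.
have gainle := card_embr_gain e phi sH.
set K := embr H (fun u w => phi u != phi w) in lossle gainle *.
suff : #|embr H e :\: K| <= #|K :\: embr H e|.
  by rewrite -(cardsID K (embr H e)) -(cardsID (embr H e) K) setIC leq_add2l.
apply: leq_trans gainle _; apply: leq_trans lossle; rewrite -/h -/n.
set I := \sum_u inner e phi u; set M := \sum_(u in Hi) missing e phi u.
have leI : d * I <= 2 * (#|Hi| * n).
  apply: (@leq_trans (d * (2 * \sum_(u in Hi) inner e phi u))).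
    rewrite leq_mul2l; apply/orP; right; rewrite mul2n -addnn.
    have -> : I = \sum_u \sum_(w | e u w && (phi u == phi w)) 1.
      by apply: eq_bigr => u _; rewrite sum1dep_card.
    apply: (@leq_trans (\sum_u \sum_(w | e u w && (phi u == phi w)) ((u \in Hi) + (w \in Hi)))).
      apply: leq_sum => u _; apply: leq_sum => w /andP[euw /eqP phiE].
      by have := inHi u w euw phiE; do 2!case: (_ \in Hi).
    rewrite (eq_bigr (fun u => \sum_(w | e u w && (phi u == phi w)) (u \in Hi : nat) +
       \sum_(w | e u w && (phi u == phi w)) (w \in Hi : nat))); last first.
      by move=> u _; rewrite big_split.
    have sumHi : \sum_u \sum_(w | e u w && (phi u == phi w)) (u \in Hi : nat) =
        \sum_(u in Hi) inner e phi u.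
      rewrite [RHS]big_mkcond; apply: eq_bigr => u _ /=; rewrite sum_nat_const.
      case: (u \in Hi); rewrite ?muln0 // muln1 /inner.
      by apply: eq_card => w; rewrite inE.
    rewrite big_split /= sumHi leq_add2l -sumHi [leqLHS](exchange_big_dep predT) //=.
    apply: eq_leq; apply: eq_bigr => w _; apply: eq_bigl => u.
    by rewrite esym eq_sym.
  rewrite mulnCA leq_mul2l /= big_distrr -sum_nat_const /=.
  by apply: leq_sum => u _; apply: ltnW.
have leM : #|Hi| * n <= 8 * k * M.
  rewrite -sum_nat_const big_distrr; apply: leq_sum => u; rewrite inE.
  exact: ltnW.
have lec : n ^ (h - 2) <= c ^ (h - 2) * q ^ (h - 2).
  by rewrite -expnMn; case: (h - 2) => // s; rewrite leq_exp2r.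
have : h ^ 2 * (I * n ^ (h - 2)) * d <= M * q ^ (h - 2) * d.
  apply: (@leq_trans (h ^ 2 * (16 * k * M) * (c ^ (h - 2) * q ^ (h - 2)))).
    have -> : h ^ 2 * (I * n ^ (h - 2)) * d = h ^ 2 * (d * I) * n ^ (h - 2) by ring.
    apply: leq_mul => //; rewrite leq_mul2l; apply/orP; right; lia.
  by apply: eq_leq; rewrite /d; ring.
by rewrite leq_pmul2r.
Qed.

End CleanupBound.

(** * Comparison with the Turan graph *)

(** For a single vertex: degree + missing + size of its part = |V| + inner, as neighbours inside of
    the part are counted twice on the left. *)
Lemma degree_balance (V Q : finType) (e : rel V) (phi : V -> Q) :
  \sum_u #|nbhd e u| + \sum_u missing e phi u + \sum_c #|part phi c| ^ 2 =
  #|V| ^ 2 + \sum_u inner e phi u.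
Proof.
have -> : \sum_c #|part phi c| ^ 2 = \sum_u #|part phi (phi u)|.
  rewrite [RHS](partition_big phi predT) //=; apply: eq_bigr => c _.
  rewrite (eq_bigr (fun=> #|part phi c|)) => [|u /eqP -> //].
  by rewrite sum_nat_const -mulnn; congr (_ * _); apply: eq_card => u; rewrite !inE.
have -> : #|V| ^ 2 = \sum_(u : V) #|V| by rewrite sum_nat_const mulnn.
rewrite -!big_split /=; apply: eq_bigr => u _.
rewrite -(cardsID (part phi (phi u)) (nbhd e u)).
have -> : #|nbhd e u :&: part phi (phi u)| = inner e phi u.
  by apply: eq_card => w; rewrite !inE [phi w == _]eq_sym.
have := cardsID (nbhd e u) (~: part phi (phi u)).
have -> : ~: part phi (phi u) :&: nbhd e u = nbhd e u :\: part phi (phi u).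
  by rewrite setDE setIC.
have -> : #|~: part phi (phi u) :\: nbhd e u| = missing e phi u.
  by apply: eq_card => w; rewrite !inE [phi w == _]eq_sym.
by move=> E; rewrite -(cardsC (part phi (phi u))) -E; ring.
Qed.

Local Open Scope ring_scope.

(** By [degree_balance], the missing pairs and the sum X of squared deviations of the part sizes
    from n / k are together at most eps n^2. The bound on eps then limits each deviation to n / (2
    k). *)
Lemma balanced_parts (V : finType) (e : rel V) k (phi : V -> 'I_k) (eps : rat) :
  (0 < k)%N -> (0 < #|V|)%N -> 0 <= eps -> eps * (4 * k%:R ^+ 2) <= 1 ->
  (1 - k%:R^-1) * #|V|%:R ^+ 2 + (\sum_u inner e phi u)%:R - eps * #|V|%:R ^+ 2 <=
    \sum_u #|nbhd e u|%:R ->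
  (\sum_u missing e phi u)%:R <= eps * #|V|%:R ^+ 2 :> rat /\
  forall c, (#|V| <= 2 * k * #|part phi c|)%N.
Proof.
move=> k_gt0 V_gt0 eps0 epsk leW; set N : rat := #|V|%:R in leW *.
have N_gt0 : 0 < N by rewrite ltr0n.
have K_gt0 : 0 < k%:R :> rat by rewrite ltr0n.
pose a c : rat := #|part phi c|%:R.
have sum_a : \sum_c a c = N.
  rewrite -natr_sum /N; congr _%:R; rewrite -sum1_card (partition_big phi predT) //=.
  by apply: eq_bigr => c _; rewrite sum1dep_card.
pose X := \sum_c (a c - N / k%:R) ^+ 2.
have XE : \sum_c a c ^+ 2 = X + k%:R^-1 * N ^+ 2.
  have -> : X = \sum_c a c ^+ 2 - 2 * (N / k%:R) * (\sum_c a c) + k%:R * (N / k%:R) ^+ 2.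
    have kE (y : rat) : k%:R * y = \sum_(c : 'I_k) y by rewrite sumr_const card_ord mulr_natl.
    rewrite mulr_sumr -sumrB kE -big_split /=.
    by apply: eq_bigr => c _; ring.
  by rewrite sum_a; field; rewrite gt_eqF.
have bal : (\sum_u #|nbhd e u|%:R) + (\sum_u missing e phi u)%:R + \sum_c a c ^+ 2 =
           N ^+ 2 + (\sum_u inner e phi u)%:R.
  have /(congr1 (fun i : nat => i%:R : rat)) := degree_balance e phi.
  rewrite !natrD natrX => <-; rewrite !natr_sum; congr (_ + _ + _).
  by apply: eq_bigr => c _; rewrite natrX.
have X0 : 0 <= X by apply: sumr_ge0 => c _; apply: sqr_ge0.
have miss0 : 0 <= (\sum_u missing e phi u)%:R :> rat by apply: ler0n.
rewrite XE in bal; move: leW bal miss0.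
set D := \sum_u #|nbhd e u|%:R; set I : rat := (\sum_u inner e phi u)%:R.
set M : rat := (\sum_u missing e phi u)%:R; set z := k%:R^-1 => leW bal miss0.
split; first by lra.
have leX : X <= eps * N ^+ 2 by lra.
move=> c; rewrite leqNgt; apply/negP => lt_c.
have lt_a : 2 * k%:R * a c < N by rewrite -!natrM ltr_nat.
have leXc : (a c - N / k%:R) ^+ 2 <= X.
  by rewrite /X (bigD1 c) //= lerDl; apply: sumr_ge0 => c' _; apply: sqr_ge0.
have : (2 * k%:R * (a c - N / k%:R)) ^+ 2 <= N ^+ 2.
  rewrite exprMn; apply: (@le_trans _ _ ((2 * k%:R) ^+ 2 * (eps * N ^+ 2))).
    by rewrite ler_wpM2l ?sqr_ge0 // (le_trans leXc).
  have -> : (2 * k%:R) ^+ 2 * (eps * N ^+ 2) = eps * (4 * k%:R ^+ 2) * N ^+ 2 by ring.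
  by rewrite ler_piMl ?sqr_ge0.
have -> : 2 * k%:R * (a c - N / k%:R) = 2 * k%:R * a c - 2 * N by field; rewrite gt_eqF.
by move=> lesq; nra.
Qed.

Local Close Scope ring_scope.

Lemma eq_set2 (T : finType) (u w x y : T) : [set u; w] = [set x; y] ->
  (u = x /\ w = y) \/ (u = y /\ w = x).
Proof.
move=> /setP E; have := E u; have := E w; have := E x; have := E y.
rewrite !inE !eqxx ?orbT /= => /pred2P yE /pred2P xE /esym/pred2P wE /esym/pred2P uE.
by case: uE => uE; case: wE => wE; case: xE => xE; case: yE => yE; subst; auto.
Qed.

Lemma gadj_turan n k (u w : 'I_n) : gadj (turan n k) u w = (u %% k != w %% k).
Proof.
rewrite /gadj inE; apply/existsP/idP => [[x /existsP[y /andP[/eqP E xy]]]|uw].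
  by case: (eq_set2 E) => -[-> ->] //; rewrite eq_sym.
by exists u; apply/existsP; exists w; rewrite eqxx.
Qed.

Lemma gadj_complete n (u w : 'I_n) : gadj (complete n) u w = (u != w).
Proof.
rewrite /gadj inE; apply/existsP/idP => [[x /existsP[y /andP[/eqP E xy]]]|uw].
  by case: (eq_set2 E) => -[-> ->] //; rewrite eq_sym.
by exists u; apply/existsP; exists w; rewrite eqxx.
Qed.

Lemma gadj_path_graph n (u w : 'I_n) :
  gadj (path_graph n) u w = (u.+1 == w :> nat) || (w.+1 == u :> nat).
Proof.
rewrite /gadj inE; apply/existsP/orP => [[x /existsP[y /andP[/eqP E xy]]]|[uw|wu]].
- by case: (eq_set2 E) => -[-> ->]; [left | right].
- by exists u; apply/existsP; exists w; rewrite eqxx.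
by exists w; apply/existsP; exists u; rewrite setUC eqxx.
Qed.

Lemma turan_nbhd_ge n k (U : {set 'I_n}) (u : 'I_n) : 0 < k ->
  n <= #|nbhd (fun u w : 'I_n => u %% k != w %% k) u :\: U| + (n %/ k).+1 + #|U|.
Proof.
move=> k_gt0; have /andP[_ le1] := card_turan_part n (Ordinal (ltn_pmod u k_gt0)).
set P := [set i : 'I_n | _] in le1; set A := _ :\: U.
have sub : [set: 'I_n] \subset A :|: (P :|: U).
  apply/subsetP => w _; rewrite !inE [w %% k == _]eq_sym /=.
  by case: (w \in U); case: (_ == _).
have := leq_trans (subset_leq_card sub) (leq_card_setU _ _); rewrite cardsT card_ord.
move=> /leq_trans; apply; rewrite -addnA leq_add2l.
by apply: leq_trans (leq_card_setU _ _) _; rewrite leq_add2r.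
Qed.

Local Open Scope ring_scope.

Lemma turan_seq_count_ge k (delta : rat) b : (0 < k)%N -> 0 < delta ->
  exists n0 : nat, forall n v, (n0 <= n)%N ->
    ((1 - k%:R^-1) ^+ count id b - delta) * n%:R ^+ size b <=
      (seq_count (fun u w : 'I_n => u %% k != w %% k)%N b v set0)%:R.
Proof.
move=> k_gt0 delta0; set h := size b; pose kappa := delta / h.+1%:R.
have h0 : 0 < h.+1%:R :> rat by rewrite ltr0n.
have kappa0 : 0 < kappa by rewrite divr_gt0.
have K_gt0 : 0 < k%:R :> rat by rewrite ltr0n.
(* For such n, kappa * n pays for the h vertices already used and for the 1 by which a part may
   exceed n / k. *)
have [n0 len0] := rat_nat_bound (h.+1%:R / kappa).
exists n0 => n v n0n; set N : rat := n%:R; have N_ge0 : 0 <= N by apply: ler0n.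
have large : h%:R + 1 <= kappa * N.
  rewrite natr1 mulrC -ler_pdivrMr //; apply: le_trans len0 _.
  by rewrite ler_nat.
have a01 : 0 <= (1 - k%:R^-1 : rat) <= 1.
  by rewrite subr_ge0 invf_le1 // ler1n k_gt0 lerBlDr lerDl invr_ge0 ltW.
apply: (@le_trans _ _ (((1 - k%:R^-1) ^+ count id b - h%:R * kappa) * N ^+ h)).
  rewrite ler_wpM2r ?exprn_ge0 // lerD2l lerN2 /kappa mulrCA ler_piMr ?(ltW delta0) //.
  by rewrite ler_pdivrMr // mul1r ler_nat.
rewrite /N -{1}[n]card_ord; apply: (@seq_count_ge _ _ _ _ h) => //; first exact: ltW.
- move=> U leU; have := cardsC U; rewrite card_ord -/N => cU.
  have -> : N = #|U|%:R + #|~: U|%:R by rewrite -natrD cU.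
  have : #|U|%:R <= h%:R :> rat by rewrite ler_nat.
  have : N = #|U|%:R + #|~: U|%:R by rewrite -natrD cU.
  by move=> EN leUh; rewrite -EN; lra.
- move=> U u leU; rewrite card_ord -/N.
  have : N <= (#|nbhd (fun u w : 'I_n => u %% k != w %% k)%N u :\: U| + (n %/ k).+1 + #|U|)%:R.
    by rewrite ler_nat turan_nbhd_ge.
  rewrite !natrD -natr1 => le1.
  have : #|U|%:R <= h%:R :> rat by rewrite ler_nat.
  have : (n %/ k)%:R <= k%:R^-1 * N.
    by rewrite mulrC ler_pdivlMr // -natrM ler_nat leq_divM.
  move: le1 large; set z := k%:R^-1; set A := _%:R; lra.
by rewrite cards0.
Qed.

Lemma count_pairmap_gt0 (V : finType) (H : {set {set V}}) x s y z :
  (forall u, u \in x :: s) -> [set y; z] \in H ->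
  index z (x :: s) = (index y (x :: s)).+1 -> (0 < count id (pairmap (gadj H) x s))%N.
Proof.
move=> alls yz idx; rewrite -has_count; apply/(has_nthP false).
have lt : (index y (x :: s) < size s)%N.
  by rewrite -ltnS -idx -[X in (_ < X)%N]/(size (x :: s)) index_mem.
exists (index y (x :: s)); first by rewrite size_pairmap.
rewrite (nth_pairmap x) //.
have -> : nth x s (index y (x :: s)) = z by rewrite -[RHS](nth_index x (alls z)) idx.
by rewrite nth_index.
Qed.

Lemma embr_le_turan (VF VH : finType) (F : {set {set VF}}) (H : {set {set VH}}) r :
  sgraph F -> has_color_critical_edge F -> chi F = r.+3 ->
  linear_forest H -> H != set0 ->
  exists n0 : nat, forall n (e : rel 'I_n), symmetric e -> irreflexive e -> embr F e = set0 ->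
    (n0 <= n)%N -> (#|embr H e| <= #|embr H (fun u w : 'I_n => u %% r.+2 != w %% r.+2)%N|)%N.
Proof.
move=> sF critF chiF lfH H0; set k := r.+2.
have [s [us alls adjs]] := linear_forest_enum lfH.
have sH : sgraph H by case: lfH.
have [A AH] := set0Pn _ H0; have [y [z [yz eA]]] := sgraph_edge sH AH.
rewrite {}eA in AH.
case: s us alls adjs => [|x s] us alls adjs; first by have := alls y.
pose b := pairmap (gadj H) x s.
have b_gt0 : (0 < count id b)%N.
  by case: (adjs _ _ AH) => idx; apply: (count_pairmap_gt0 alls _ idx); rewrite // setUC.
(* Parity of the position in the list is a bipartition of H. *)
pose psi u := odd (index u (x :: s)).
have psiH u w : [set u; w] \in H -> psi u != psi w.
  by move=> /adjs[] E; rewrite /psi E /=; case: (odd _).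
have k_gt0 : (0 < k)%N by [].
have [m [n1 [m_gt0 cleanup]]] := embr_le_multipartite sF critF chiF k_gt0 sH psiH AH.
have K_gt0 : 0 < k%:R :> rat by rewrite ltr0n.
have M_gt0 : 0 < m%:R :> rat by rewrite ltr0n.
(* The two terms serve the bound on missing pairs in the cleanup and the balance of the parts. Half
   of eps is spent on the inner edges of the colouring, the other half on the degree deficit
   [gamma']. *)
pose eps : rat := Num.min (m%:R ^+ 2)^-1 (4 * k%:R ^+ 2)^-1.
have eps0 : 0 < eps by rewrite lt_min !invr_gt0 ?mulr_gt0 // !exprn_gt0.
have epsm : m%:R ^+ 2 * eps <= 1.
  by rewrite mulrC -ler_pdivlMr ?exprn_gt0 // div1r ge_min lexx.
have epsk : eps * (4 * k%:R ^+ 2) <= 1.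
  by rewrite -ler_pdivlMr ?mulr_gt0 ?exprn_gt0 // div1r ge_min lexx orbT.
have beta0 : 0 < eps / 2 by rewrite divr_gt0.
have [gamma gamma0 [n2 stab]] := stability sF critF chiF beta0.
pose gamma' := Num.min gamma (eps / 2).
have gamma'0 : 0 < gamma' by rewrite lt_min gamma0 beta0.
have a_gt0 : 0 < 1 - k%:R^-1 :> rat by rewrite subr_gt0 invf_lt1 // ltr1n.
have a_le1 : 1 - k%:R^-1 <= 1 :> rat by rewrite lerBlDr lerDl invr_ge0 ltW.
have [|delta delta0 walks] := @many_walks_many_edges (1 - k%:R^-1) gamma' b _ gamma'0 b_gt0.
  by rewrite a_gt0.
have [n3 MS] := free_motzkin_straus sF critF chiF delta0.
have [n4 turan_ge] := turan_seq_count_ge (false :: b) k_gt0 delta0.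
exists (maxn (maxn n1 n2) (maxn n3 n4)).+1 => n e esym eirr free nn.
have := ltnW nn; rewrite -[n in (_ <= n)%N](card_ord n) !geq_max.
move=> /andP[/andP[n1n n2n] /andP[n3n n4n]].
set ET := #|embr H (fun u w : 'I_n => u %% k != w %% k)%N|.
(* Only now may e be assumed to have as many embeddings as the Turan graph, which is what forces its
   number of edges. *)
have /orP[//|le_T] := leq_total #|embr H e| ET.
have n_gt0 : (0 < n)%N by apply: leq_ltn_trans nn.
pose v : 'I_n := Ordinal n_gt0.
have cardE (e' : rel 'I_n) : symmetric e' -> #|embr H e'| = seq_count e' (false :: b) v set0.
  by move=> e'sym; apply: card_embr.
have symT : symmetric (fun u w : 'I_n => u %% k != w %% k)%N by move=> u w; rewrite eq_sym.
set N : rat := n%:R; have N_gt0 : 0 < N by rewrite ltr0n.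
have degs : (1 - k%:R^-1 - gamma') * N ^+ 2 <= \sum_u #|nbhd e u|%:R.
  have := walks 'I_n e v esym; rewrite card_ord -/N; apply.
    exact: MS esym eirr free n3n.
  rewrite -cardE //; apply: (@le_trans _ _ ET%:R); last by rewrite ler_nat.
  by rewrite /ET cardE //; apply: (turan_ge n v); rewrite card_ord in n4n.
have leg : gamma' <= gamma by rewrite ge_min lexx.
have leb : gamma' <= eps / 2 by rewrite ge_min lexx orbT.
have [|phi0 inner0] := stab 'I_n e esym eirr free n2n; rewrite ?card_ord -/N.
  by apply: le_trans degs; rewrite ler_wpM2r ?sqr_ge0 // lerD2l lerN2.
rewrite card_ord -/N in inner0.
have [phi le_phi opt] := exists_optimal_coloring esym eirr phi0.
have inner1 : (\sum_u inner e phi u)%:R <= eps / 2 * N ^+ 2.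
  by apply: le_trans inner0; rewrite ler_nat.
have V_gt0 : (0 < #|'I_n|)%N by rewrite card_ord.
have [|miss large] := @balanced_parts 'I_n e k phi eps k_gt0 V_gt0 (ltW eps0) epsk.
  rewrite card_ord -/N.
  have : gamma' * N ^+ 2 <= eps / 2 * N ^+ 2 by rewrite ler_wpM2r ?sqr_ge0.
  move: degs inner1; set zz := k%:R^-1; lra.
rewrite card_ord -/N in miss.
apply: leq_trans (card_embr_multipartite_le_turan phi lfH).
apply: (cleanup _ _ _ esym eirr free n1n opt _ large).
rewrite card_ord -(ler_nat rat) natrX !natrM -/N.
apply: (@le_trans _ _ (m%:R ^+ 2 * eps * N ^+ 2)).
  by rewrite -expr2 -mulrA ler_wpM2l ?sqr_ge0.
by rewrite ler_piMl ?sqr_ge0.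
Qed.

Local Close Scope ring_scope.

(** The premise [H != set0] lets this also cover an edgeless H, for which e and e' may be
    arbitrary. *)
Lemma embr_sub (VH V : finType) (H : {set {set VH}}) (e e' : rel V) :
  (forall u w, H != set0 -> e u w -> e' u w) -> embr H e \subset embr H e'.
Proof.
move=> ee'; apply/subsetP => f /embrP[fi fe]; apply/embrP; split=> // x y xy.
by apply: ee'; [apply/set0Pn; exists [set x; y] | apply: fe].
Qed.

(** If chi F = 2, then F is its critical edge together with isolated vertices, so any edge in a
    large enough graph gives a copy. *)
Lemma free_edgeless (VF V : finType) (F : {set {set VF}}) (e : rel V) u w :
  sgraph F -> has_color_critical_edge F -> chi F = 2 -> symmetric e -> irreflexive e ->
  embr F e = set0 -> #|VF| + 2 <= #|V| -> ~~ e u w.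
Proof.
move=> sF critF chiF esym eirr free VFV; apply/negP => euw.
suff: embr F e != set0 by rewrite free eqxx.
apply: (@critical_embedding VF V F 1 e (fun=> ~: [set u; w]) ord0 u w) => //.
- by rewrite !inE eqxx.
- by rewrite !inE eqxx orbT.
- by move=> i; rewrite ord1.
- by move=> i i'; rewrite !ord1.
move=> _; have := cardsC [set u; w]; have : #|[set u; w]| <= 2 by rewrite cards2; case: eqP.
by lia.
Qed.

(** The upper bound for k >= 2 and H with an edge comes from [embr_le_turan]. If H has no edge, all
    graphs on n vertices have equally many embeddings; if k = 1, large F-free graphs are
    edgeless. *)
Lemma turan_good (VF VH : finType) (F : {set {set VF}}) (H : {set {set VH}}) k :
  sgraph F -> has_color_critical_edge F -> chi F = k.+1 -> linear_forest H ->
  exists n0, forall n, n0 <= n -> exHF n H F = Ncopies H (turan n k).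
Proof.
move=> sF critF chiF lfH; have sH : sgraph H by case: lfH.
have k_gt0 : 0 < k.
  have [a [_ [c _]]] := critical_coloring sF critF chiF.
  exact: leq_ltn_trans (ltn_ord (c a)).
have turanE n : embeddings H (turan n k) = embr H (fun u w : 'I_n => u %% k != w %% k).
  rewrite embeddingsE //; apply/eqP; rewrite eqEsubset.
  by apply/andP; split; apply: embr_sub => u w _; rewrite gadj_turan.
suff [n0 bound] : exists n0, forall n (e : rel 'I_n), symmetric e -> irreflexive e ->
    embr F e = set0 -> n0 <= n ->
    #|embr H e| <= #|embr H (fun u w : 'I_n => u %% k != w %% k)|.
  exists n0 => n n0n; apply/eqP; rewrite eqn_leq; apply/andP; split.
    apply/bigmax_leqP => G /andP[sG freeG]; apply: Ncopies_le; rewrite turanE embeddingsE //.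
    apply: bound => //; [exact: gadj_sym | exact: gadj_irr |].
    by rewrite -embeddingsE //; apply/eqP.
  have sT : sgraph (turan n k).
    apply/forallP => A; apply/implyP; rewrite inE => /existsP[x /existsP[y /andP[/eqP -> xy]]].
    by rewrite cards2 (_ : x != y) //; apply: contraNneq xy => ->.
  apply: leq_bigmax_cond; rewrite sT /= /Ffree embeddingsE //.
  apply/eqP/setP => f; rewrite [RHS]inE; apply/negP => /embrP[fi fT].
  (* An embedding of F into the Turan graph would colour F by residues modulo k. *)
  suff : colorable F k by move/(chi_le sF); rewrite chiF ltnn.
  apply/colorableP; exists (fun x => Ordinal (ltn_pmod (f x) k_gt0)) => x y /fT.
  by rewrite gadj_turan.
have trivial n (e : rel 'I_n) : (H != set0 -> forall u w, ~~ e u w) ->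
    #|embr H e| <= #|embr H (fun u w : 'I_n => u %% k != w %% k)|.
  move=> noe; apply: subset_leq_card; apply: embr_sub => u w /noe/(_ u w).
  by move/negbTE => ->.
have [H0|H0] := eqVneq H set0.
  by exists 0 => n e _ _ _ _; apply: trivial; rewrite H0 eqxx.
case: k chiF k_gt0 {turanE} trivial => [//|[|r]] chiF _ trivial.
  exists (#|VF| + 2) => n e esym eirr free len; apply: trivial => _ u w.
  by apply: free_edgeless free _; rewrite ?card_ord.
exact: embr_le_turan.
Qed.

(** * Complete graphs and paths *)

Lemma sgraph_complete n : sgraph (complete n).
Proof.
apply/forallP => A; apply/implyP; rewrite inE => /existsP[x /existsP[y /andP[/eqP -> xy]]].
by rewrite cards2 xy.
Qed.

Lemma chi_complete n : chi (complete n) = n.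
Proof.
have sC := sgraph_complete n.
apply/eqP; rewrite eqn_leq; apply/andP; split.
  by rewrite -[leqRHS](card_ord n); apply: chi_le => //; apply: colorable_card.
have /colorableP[c cC] := chi_colorable sC.
have ci : injective c.
  move=> x y; apply: contra_eq => xy; apply: cC; by rewrite -/(gadj _ x y) gadj_complete.
by have := leq_card c ci; rewrite !card_ord.
Qed.

Lemma complete_color_critical k : 0 < k -> has_color_critical_edge (complete k.+1).
Proof.
move=> k_gt0; pose A : {set 'I_k.+1} := [set ord0; ord_max].
have AC : A \in complete k.+1.
  rewrite -/(gadj _ ord0 ord_max) gadj_complete -val_eqE /=.
  by rewrite eq_sym -lt0n.
apply/exists_inP; exists A => //; rewrite chi_complete ltnS; apply: chi_le.
  apply/forallP => B; apply/implyP; rewrite inE => /andP[_].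
  by have /forallP/(_ B)/implyP := sgraph_complete k.+1.
(* Once the edge between the first and the last vertex is deleted, these two can share the colour
   0. *)
have ltc (i : 'I_k.+1) : (if i == k :> nat then 0 else i) < k.
  by have := ltn_ord i; case: eqP => //; lia.
apply/colorableP; exists (fun i => Ordinal (ltc i)) => x y.
rewrite inE -/(gadj (complete k.+1) x y) gadj_complete inE => /andP[xyA xy].
apply: contraNneq xyA => /(congr1 val) /=.
case: (eqVneq (x : nat) k) => xk; case: (eqVneq (y : nat) k) => yk E.
- by case/negP: xy; apply/eqP/val_inj; rewrite /= xk.
- by rewrite setUC; apply/eqP; congr [set _; _]; apply: val_inj.
- by apply/eqP; congr [set _; _]; apply: val_inj.
by case/negP: xy; apply/eqP/val_inj.
Qed.

Lemma linear_forest_path_graph l : linear_forest (path_graph l).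
Proof.
split.
  apply/forallP => A; apply/implyP; rewrite inE => /existsP[x /existsP[y /andP[/eqP -> xy]]].
  by rewrite cards2 (_ : x != y) //; apply: contraTneq xy => ->; rewrite gtn_eqF.
move=> v; have symP : connect_sym (gadj (path_graph l)).
  by apply: sym_connect_sym; apply: gadj_sym.
have from0 (i : 'I_l) (w : 'I_l) : i = 0 :> nat -> connect (gadj (path_graph l)) i w.
  move=> i0; case: w => m; elim: m => [|m IH] ltm.
    by rewrite (_ : i = Ordinal ltm) //; apply: val_inj.
  apply: connect_trans (IH (ltnW ltm)) (connect1 _).
  by rewrite gadj_path_graph /= eqxx.
have compT : component (path_graph l) v = setT.
  apply/setP => w; rewrite !inE; have l_gt0 : 0 < l by apply: leq_ltn_trans (ltn_ord v).
  apply: (@connect_trans _ _ (Ordinal l_gt0)); last exact: from0.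
  by rewrite symP; apply: from0.
have cl : #|component (path_graph l) v| = l by rewrite compT cardsT card_ord.
have inC w : w \in component (path_graph l) v by rewrite compT inE.
exists (cast_ord cl); split=> //; first exact: cast_ord_inj.
by move=> i j; rewrite -/(gadj _ _ _) gadj_path_graph.
Qed.

Theorem mainTheorem1 :
  (forall (VF VH : finType) (F : {set {set VF}}) (H : {set {set VH}}) (k : nat),
      sgraph F -> has_color_critical_edge F -> chi F = k.+1 ->
      linear_forest H ->
      exists n0 : nat, forall n : nat, n0 <= n ->
        exHF n H F = Ncopies H (turan n k))
  /\
  (forall k l : nat, 2 <= k -> 1 <= l ->
      exists n0 : nat, forall n : nat, n0 <= n ->
        exHF n (path_graph l) (complete k.+1) = Ncopies (path_graph l) (turan n k)).
Proof.
split=> [VF VH F H k|k l k2 _]; first exact: turan_good.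
apply: turan_good (linear_forest_path_graph l).
- exact: sgraph_complete.
- by apply: complete_color_critical; apply: ltnW.
- exact: chi_complete.
Qed.
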